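(* Suppose that for every integer $n\ge 1$ and every finite subgroup $1\neq H\le \mathrm{GL}_n(\mathbb{Z})$ there is a constant $c_H>0$ (depending only on $H$) such that $$N_n^{\mathrm{tor}}(X;H)\sim c_H\, X^{\frac{1}{a(H)}}(\log X)^{b(H)-1}\qquad (X\to\infty).$$ Then for every integer $n\ge 1$ there exists a constant $c_n>0$ such that $$N_n^{\mathrm{tor}}(X)\sim c_n\, X(\log X)^{n-1}\qquad (X\to\infty).$$
   Context: $G_{\mathbb{Q}}=\mathrm{Gal}(\overline{\mathbb{Q}}/\mathbb{Q})$. Tori and conductors. Let $T$ be an $n$-dimensional algebraic torus over $\mathbb{Q}$ with character lattice $X^*(T)=\mathrm{Hom}_{\overline{\mathbb{Q}}}(T_{\overline{\mathbb{Q}}},\mathbb{G}_{m,\overline{\mathbb{Q}}})$. The $G_{\mathbb{Q}}$-action on $X^*(T)$ gives a representation $\rho_T: G_{\mathbb{Q}}\to \mathrm{Aut}(X^*(T))\cong \mathrm{GL}_n(\mathbb{Z})$, well-defined up to conjugation; $G_T:=\mathrm{im}(\rho_T)$, a finite subgroup of $\mathrm{GL}_n(\mathbb{Z})$ well-defined up to conjugation, isomorphic to $\mathrm{Gal}(L/\mathbb{Q})$ where $L$ is the splitting field of $T$. $C(T)$ denotes the Artin conductor (a positive integer) of the character of the representation $\mathrm{Gal}(L/\mathbb{Q})\to \mathrm{Aut}(X^*(T)\otimes\mathbb{Q})\cong \mathrm{GL}_n(\mathbb{Q})$ induced by $\rho_T$. Counting functions. $N_n^{\mathrm{tor}}(X)$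 is the number of isomorphism classes of $n$-dimensional tori $T$ over $\mathbb{Q}$ with $C(T)\le X$. For a finite subgroup $H\ne 1$ of $\mathrm{GL}_n(\mathbb{Z})$, $N_n^{\mathrm{tor}}(X;H)$ is the number of those isomorphism classes for which moreover $G_T$ is conjugate to $H$ in $\mathrm{GL}_n(\mathbb{Z})$. The invariants $a(H)$, $b(H)$. For a finite subgroup $1\ne H\le\mathrm{GL}_n(\mathbb{Z})$ with identity matrix $I_n$, put $a(H):=\min_{h\in H\setminus\{I_n\}}\mathrm{rank}(h-I_n)$. Let $\chi:G_{\mathbb{Q}}\to(\mathbb{Z}/|H|\mathbb{Z})^\times$ be the mod-$|H|$ cyclotomic character and let $\sigma\in G_{\mathbb{Q}}$ act on $H$ by $\sigma(h):=h^{\chi(\sigma)}$. This induces an action of $G_{\mathbb{Q}}$ on the set $\mathrm{Cl}(H)$ of conjugacy classes of $H$; $\mathrm{rank}(h-I_n)$ depends only on the $G_{\mathbb{Q}}$-orbit of the conjugacy class of $h$. $b(H)$ is the number of $G_{\mathbb{Q}}$-orbits on $\mathrm{Cl}(H)$ whose members' elements $h$ satisfy $\mathrm{rank}(h-I_n)=a(H)$. *)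

(* Defs.v *)
From HB Require Import structures.
From mathcomp Require Import all_boot all_order all_algebra all_fingroup.
From mathcomp Require Import all_field mxrepresentation finmap.
From mathcomp Require Import all_classical all_reals all_analysis.

Set Implicit Arguments.
Unset Strict Implicit.
Unset Printing Implicit Defensive.

Import Order.TTheory GRing.Theory Num.Theory.
Import numFieldNormedType.Exports.

Local Open Scope classical_set_scope.
Local Open Scope ring_scope.

(* Conventions.  Qbar is algC.  G_Q is {rmorphism algC -> algC}: every ring
   endomorphism of algC is an automorphism, with inverse algC_invaut.
   Algebraic groups over Q are taken in the classical language: Zariski-closed
   subgroups of GL_N(Qbar) defined over Q, with maps given by regular
   functions. *)

(* The number of elements of a finite set (and 0 for an infinite one). *)
Definition ncard (T : Type) (A : set T) : nat := xget 0%N [set k | (A #= `I_k)%card].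

Definition asymp_equiv (R : realType) (f g : R -> R) : Prop :=
  f X / g X @[X --> +oo] --> (1 : R).

(* The k-algebra k[x_ij, 1/det] of regular functions on GL_N; values on
   singular matrices are irrelevant. *)
Inductive regfun (k : {pred algC}) (N : nat) : ('M[algC]_N -> algC) -> Prop :=
| regfun_cst c of c \in k : regfun k (fun=> c)
| regfun_entry i j : regfun k (fun x => x i j)
| regfun_invdet : regfun k (fun x => (\det x)^-1)
| regfun_add f g of regfun k f & regfun k g : regfun k (fun x => f x + g x)
| regfun_mul f g of regfun k f & regfun k g : regfun k (fun x => f x * g x).

(* In characteristic 0, being cut out by functions with coefficients in Q is
   the same as being defined over Q. *)
Record Qgroup := MkQgroup {
  deg : nat;
  pts : set 'M[algC]_deg;
  pts_unit : forall x, pts x -> x \in unitmx;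
  pts_closed : exists S : set ('M[algC]_deg -> algC),
    (forall f, S f -> regfun Crat f) /\
    (forall x, x \in unitmx -> (pts x <-> forall f, S f -> f x = 0));
  pts_1 : pts 1%:M;
  pts_mul : forall x y, pts x -> pts y -> pts (x *m y);
  pts_inv : forall x, pts x -> pts (invmx x) }.
Arguments pts : clear implicits.

(* Isomorphism over k between closed subgroups of GL_N and GL_M. *)
Definition isom_over (k : {pred algC}) N M
    (G : set 'M[algC]_N) (H : set 'M[algC]_M) : Prop :=
  exists (phi : 'M[algC]_N -> 'M[algC]_M) (psi : 'M[algC]_M -> 'M[algC]_N),
    [/\ forall i j, regfun k (fun x => phi x i j),
        forall i j, regfun k (fun y => psi y i j),
        forall x, G x -> H (phi x) /\ psi (phi x) = x,
        forall y, H y -> G (psi y) /\ phi (psi y) = y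
      & forall x x', G x -> G x' -> phi (x *m x') = phi x *m phi x'].

(* G_m^n as the group of invertible diagonal matrices. *)
Definition Gm_pow (n : nat) : set 'M[algC]_n :=
  [set x | x \in unitmx /\ is_diag_mx x].

Definition is_torus (n : nat) (T : Qgroup) : Prop :=
  isom_over predT (pts T) (@Gm_pow n).

Section Characters.
Variable T : Qgroup.

Lemma regfun_sum k N (I : finType) (F : I -> 'M[algC]_N -> algC) :
  0 \in k -> (forall i, regfun k (F i)) -> regfun k (fun x => \sum_i F i x).
Proof.
move=> k0 rF.
elim: (index_enum I) => [|i s IHs].
  by under eq_fun do rewrite big_nil; exact: regfun_cst.
by under eq_fun do rewrite big_cons; apply: regfun_add.
Qed.

Lemma regfun_prod k N (I : finType) (F : I -> 'M[algC]_N -> algC) :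
  1 \in k -> (forall i, regfun k (F i)) -> regfun k (fun x => \prod_i F i x).
Proof.
move=> k1 rF.
elim: (index_enum I) => [|i s IHs].
  by under eq_fun do rewrite big_nil; exact: regfun_cst.
by under eq_fun do rewrite big_cons; apply: regfun_mul.
Qed.

Lemma regfun_det N m (F : 'I_m -> 'I_m -> 'M[algC]_N -> algC) :
  (forall i j, regfun predT (F i j)) ->
  regfun predT (fun x => \det (\matrix_(i, j) F i j x)).
Proof.
move=> rF; apply: regfun_sum => // s; apply: regfun_mul.
  exact: regfun_cst.
apply: regfun_prod => // i.
by under eq_fun do rewrite mxE; exact: rF.
Qed.

Lemma regfun_invmx N (f : 'M[algC]_N -> algC) : regfun predT f ->
  exists2 g, regfun predT g & forall x, x \in unitmx -> f (invmx x) = g x.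
Proof.
elim=> [c ck|i j||f1 f2 _ [g1 r1 E1] _ [g2 r2 E2]|f1 f2 _ [g1 r1 E1] _ [g2 r2 E2]].
- by exists (fun=> c) => //; exact: regfun_cst.
- exists (fun x => (\det x)^-1 * (\adj x i j)); last first.
    by move=> x ux; rewrite /invmx ux mxE.
  apply: regfun_mul; first exact: regfun_invdet.
  under eq_fun do rewrite mxE.
  apply: regfun_mul; first exact: regfun_cst.
  have -> : (fun x : 'M[algC]_N => \det (row' j (col' i x))) =
    (fun x => \det (\matrix_(a, b) (fun y : 'M[algC]_N =>
                 y (lift j a) (lift i b)) x)).
    by apply/funext => x; congr (\det _); apply/matrixP => a b; rewrite !mxE.
  by apply: regfun_det => a b; exact: regfun_entry.
- exists (fun x => \det (\matrix_(a, b) (fun y : 'M[algC]_N => y a b) x)).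
    by apply: regfun_det => a b; exact: regfun_entry.
  move=> x ux; rewrite det_inv invrK; congr (\det _).
  by apply/matrixP => a b; rewrite mxE.
- exists (fun x => g1 x + g2 x); first exact: regfun_add.
  by move=> x ux; rewrite E1 ?E2.
- exists (fun x => g1 x * g2 x); first exact: regfun_mul.
  by move=> x ux; rewrite E1 ?E2.
Qed.

Lemma regfun_Crat N (f : 'M[algC]_N -> algC) (s : {rmorphism algC -> algC}) :
  regfun Crat f -> forall x, f (map_mx s x) = s (f x).
Proof.
elim=> [c cQ x|i j x|x|f1 f2 _ E1 _ E2 x|f1 f2 _ E1 _ E2 x].
- by rewrite aut_Crat.
- by rewrite mxE.
- by rewrite det_map_mx fmorphV.
- by rewrite E1 E2 rmorphD.
- by rewrite E1 E2 rmorphM.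
Qed.

Lemma pts_gal (s : {rmorphism algC -> algC}) x : pts T x <-> pts T (map_mx s x).
Proof.
have [S [SQ TS]] := pts_closed T.
split=> Tx.
  have ux := pts_unit Tx.
  apply/TS; first by rewrite map_unitmx.
  by move=> f Sf; rewrite (regfun_Crat _ (SQ _ Sf)) (TS _ ux).1 ?rmorph0.
have ux : x \in unitmx by rewrite -(map_unitmx s); exact: pts_unit Tx.
apply/TS => // f Sf; apply: (fmorph_inj s).
by rewrite -(regfun_Crat _ (SQ _ Sf)) rmorph0 (TS _ (pts_unit Tx)).1.
Qed.

(* Homomorphisms of algebraic groups T_Qbar -> G_m, as functions on the
   Qbar-points, extended by 0 outside T. *)
Definition is_char (chi : 'M[algC]_(deg T) -> algC) : Prop :=
  [/\ forall x, ~ pts T x -> chi x = 0,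
      forall x, pts T x -> chi x != 0,
      forall x y, pts T x -> pts T y -> chi (x *m y) = chi x * chi y
    & exists2 f, regfun predT f & forall x, pts T x -> chi x = f x].

Record char := MkChar { cfun :> 'M[algC]_(deg T) -> algC; cfunP : is_char cfun }.

Lemma char_ext (c d : char) : (forall x, pts T x -> c x = d x) -> c = d.
Proof.
move: c d => [c cP] [d dP] /= cd.
have E : c = d.
  apply/funext => x; have [/cd //|nTx] := pselect (pts T x).
  by have [-> // _ _ _] := cP; have [-> // _ _ _] := dP.
by move: E cP dP {cd} => -> cP dP; congr MkChar; exact: Prop_irrelevance.
Qed.

Lemma char1_subproof : is_char (fun x => (`[< pts T x >])%:R).
Proof.
split=> [x /asboolPn/negbTE -> //|x /asboolT ->|x y Tx Ty|].
- exact: oner_neq0.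
- by rewrite !asboolT ?mulr1 //; exact: pts_mul.
- by exists (fun=> 1); [exact: regfun_cst|move=> x /asboolT ->].
Qed.
Definition char1 := MkChar char1_subproof.

Lemma charM_subproof (c d : char) : is_char (fun x => c x * d x).
Proof.
case: c d => c [c0 c1 cM [f rf cf]] [d [d0 d1 dM [g rg dg]]] /=.
split=> [x /c0 ->|x Tx|x y Tx Ty|]; first by rewrite mul0r.
- by rewrite mulf_neq0 ?c1 ?d1.
- by rewrite cM // dM // mulrACA.
- exists (fun x => f x * g x); first exact: regfun_mul.
  by move=> x Tx; rewrite cf // dg.
Qed.
Definition charM c d := MkChar (charM_subproof c d).

Lemma charV_subproof (c : char) : is_char (fun x => (c x)^-1).
Proof.
case: c => c [c0 c1 cM [f rf cf]] /=.
split=> [x /c0 ->|x Tx|x y Tx Ty|]; first by rewrite invr0.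
- by rewrite invr_eq0 c1.
- by rewrite cM // invfM.
have [g rg fg] := regfun_invmx rf; exists g => // x Tx.
have ux := pts_unit Tx; have Tx' := pts_inv Tx.
rewrite -fg // -cf //.
have cx : c 1%:M = 1.
  have := cM _ _ (pts_1 T) (pts_1 T); rewrite mul1mx => /esym/eqP.
  by rewrite -subr_eq0 -{3}[c _]mulr1 -mulrBr mulf_eq0 (negbTE (c1 _ (pts_1 T)))
    subr_eq0 => /eqP.
apply: (mulfI (c1 _ Tx)).
by rewrite mulfV ?c1 // -cM // mulmxV.
Qed.
Definition charV c := MkChar (charV_subproof c).

HB.instance Definition _ := gen_eqMixin char.
HB.instance Definition _ := gen_choiceMixin char.

Lemma charMA : associative charM.
Proof. by move=> a b c; apply: char_ext => x _ /=; rewrite mulrA. Qed.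
Lemma charMC : commutative charM.
Proof. by move=> a b; apply: char_ext => x _ /=; rewrite mulrC. Qed.
Lemma char1M : left_id char1 charM.
Proof. by move=> a; apply: char_ext => x Tx /=; rewrite asboolT ?mul1r. Qed.
Lemma charVM : left_inverse char1 charV charM.
Proof.
move=> a; apply: char_ext => x Tx /=; rewrite asboolT // mulVf //.
by have [_ /(_ x Tx)] := cfunP a.
Qed.

(* The group X^*(T), written additively. *)
HB.instance Definition _ :=
  GRing.isZmodule.Build char charMA charMC char1M charVM.

Lemma galact_subproof (s : {rmorphism algC -> algC}) (c : char) :
  is_char (fun x => s (c (map_mx (algC_invaut s) x))).
Proof.
case: c => c [c0 c1 cM [f rf cf]] /=.
split=> [x nTx|x Tx|x y Tx Ty|].
- by rewrite c0 ?rmorph0 // -pts_gal.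
- by rewrite fmorph_eq0 c1 // -pts_gal.
- by rewrite map_mxM cM -?pts_gal // rmorphM.
have {rf} : exists2 g, regfun predT g &
    forall x, s (f (map_mx (algC_invaut s) x)) = g x.
  elim: rf => [a _|i j||f1 f2 _ [g1 r1 E1] _ [g2 r2 E2]
                       |f1 f2 _ [g1 r1 E1] _ [g2 r2 E2]].
  - by exists (fun=> s a) => //; exact: regfun_cst.
  - exists (fun x => x i j); first exact: regfun_entry.
    by move=> x; rewrite mxE algC_invautK.
  - exists (fun x => (\det x)^-1); first exact: regfun_invdet.
    by move=> x; rewrite det_map_mx -fmorphV algC_invautK.
  - exists (fun x => g1 x + g2 x); first exact: regfun_add.
    by move=> x; rewrite rmorphD E1 E2.
  - exists (fun x => g1 x * g2 x); first exact: regfun_mul.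
    by move=> x; rewrite rmorphM E1 E2.
by case=> g rg fg; exists g => // x Tx; rewrite -fg cf // -pts_gal.
Qed.

(* (s . chi)(x) = s (chi (s^-1 x)) *)
Definition galact (s : {rmorphism algC -> algC}) (c : char) : char :=
  MkChar (galact_subproof s c).

Definition char_basis n (e : 'I_n -> char) : Prop :=
  forall c : char, exists! m : 'I_n -> int, c = \sum_i e i *~ m i.

(* M is the matrix of s acting on X^*(T) in the basis e (columns are the
   coordinates of the images of the basis vectors). *)
Definition galact_mx n (e : 'I_n -> char) (s : {rmorphism algC -> algC})
    (M : 'M[int]_n) : Prop :=
  forall j, galact s (e j) = \sum_i e i *~ M i j.

(* The image of rho_T in GL_n(Z), for the identification of Aut(X^*(T)) with
   GL_n(Z) given by e. *)
Definition gal_image n (e : 'I_n -> char) : set 'M[int]_n :=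
  [set M | exists s, galact_mx e s M].

(* The splitting field of T: the fixed field of the kernel of rho_T. *)
Definition splitting_field : set algC :=
  [set x | forall s : {rmorphism algC -> algC},
     (forall c, galact s c = c) -> s x = x].

End Characters.

Section ArtinConductor.
Variable L : splittingFieldType rat.

Definition OL : set L := [set x | integralOver (intr : int -> L) x].

(* P is a prime ideal of the ring of integers of L lying above p. *)
Definition prime_ideal_above (p : nat) (P : set L) : Prop :=
  [/\ P `<=` OL /\ P p%:R,
      forall x y, P x -> P y -> P (x + y),
      forall a x, OL a -> P x -> P (a * x),
      ~ P 1
    & forall x y, OL x -> OL y -> P (x * y) -> P x \/ P y].

Fixpoint ideal_pow (P : set L) (k : nat) : set L :=
  if k is k'.+1 then
    [set x | exists m (a b : 'I_m -> L),
       (forall i, P (a i) /\ ideal_pow P k' (b i)) /\ x = \sum_i a i * b i]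
  else OL.

(* The i-th ramification group of P, in the lower numbering. *)
Definition ramification_group (P : set L) (i : nat) :
    {set gal_of {:L}%VS} :=
  [set g in 'Gal({:L} / 1)%g |
     `[< forall x, OL x -> ideal_pow P i.+1 (g x - x) >]].

Variables (n : nat) (rho : mx_representation rat 'Gal({:L} / 1)%g n).

(* sum_(i >= 0) |G_i| / |G_0| * codim V^(G_i); the sum has finite support. *)
Definition artin_exponent (P : set L) : rat :=
  \sum_(i \in [set: nat])
    ((#|ramification_group P i|%:R / #|ramification_group P 0|%:R : rat)
     * (n - \rank (rfix_mx rho (ramification_group P i)))%:R).

(* The exponent at p does not depend on the prime chosen above p. *)
Definition artin_conductor (R : realType) : R :=
  \big[*%R/1]_(p \in [set p : nat | prime p])
    ((p%:R : R) `^ ratr (artin_exponent (xget set0 (prime_ideal_above p)))).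

End ArtinConductor.

(* rho is the representation of Gal(L/Q) on the rational character space of T
   induced by rho_T, where iota identifies L with the splitting field of T.
   The transpose accounts for matrices of mx_representation acting on row
   vectors (and products in 'Gal being taken in diagrammatic order). *)
Definition induced_rep (T : Qgroup) (n : nat) (L : splittingFieldType rat)
    (iota : {rmorphism L -> algC})
    (rho : mx_representation rat 'Gal({:L} / 1)%g n) : Prop :=
  range iota = splitting_field T /\
  exists2 e : 'I_n -> char T, char_basis e &
    forall (s : {rmorphism algC -> algC}) (g : gal_of {:L}%VS) (M : 'M[int]_n),
      g \in 'Gal({:L} / 1)%g -> (forall y, s (iota y) = iota (g y)) ->
      galact_mx e s M -> rho g = (map_mx intr M)^T.

Definition conductor (R : realType) (n : nat) (T : Qgroup) : R :=
  xget 1 [set c | exists (L : splittingFieldType rat)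
    (iota : {rmorphism L -> algC})
    (rho : mx_representation rat 'Gal({:L} / 1)%g n),
    induced_rep T iota rho /\ c = artin_conductor rho R].

Definition conj_GLnZ n (A B : set 'M[int]_n) : Prop :=
  exists2 g, g \in unitmx & A = [set g *m h *m invmx g | h in B].

Definition iso_class (T : Qgroup) : set Qgroup :=
  [set T' | isom_over Crat (pts T) (pts T')].

Definition Ntor (R : realType) (n : nat) (X : R) : nat :=
  ncard [set iso_class T | T in
    [set T | is_torus n T /\ conductor R n T <= X]].

Definition NtorH (R : realType) (n : nat) (H : {fset 'M[int]_n}) (X : R) : nat :=
  ncard [set iso_class T | T in
    [set T | [/\ is_torus n T, conductor R n T <= X &
       exists2 e : 'I_n -> char T, char_basis e &
         conj_GLnZ (gal_image e) [set` H]]]].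

Section Invariants.
Variables (n : nat) (H : {fset 'M[int]_n}).

Definition finite_subgroup : Prop :=
  [/\ 1%:M \in H,
      forall g, g \in H -> g \in unitmx /\ invmx g \in H
    & forall g h, g \in H -> h \in H -> g *m h \in H].

Definition rk (h : 'M[int]_n) : nat :=
  \rank (map_mx (intr : int -> rat) (h - 1%:M)).

(* Ranks are at most n, so the default value n does not affect the minimum
   when H is nontrivial. *)
Definition a_inv : nat := \big[minn/n]_(h <- H | h != 1%:M) rk h.

Definition conj_class (h : 'M[int]_n) : set 'M[int]_n :=
  [set invmx g *m h *m g | g in [set` H]].

(* k represents the value at s of the mod-m cyclotomic character. *)
Definition cyclo_exp (m : nat) (s : {rmorphism algC -> algC}) (k : nat) :=
  forall z : algC, z ^+ m = 1 -> s z = z ^+ k.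

Definition cyclo_act (s : {rmorphism algC -> algC}) (C : set 'M[int]_n) :
    set 'M[int]_n :=
  [set h' | exists h k, [/\ C h, cyclo_exp #|` H| s k & h' = h ^+ k]].

Definition class_orbit (C : set 'M[int]_n) : set (set 'M[int]_n) :=
  [set C' | exists s, C' = cyclo_act s C].

Definition b_inv : nat :=
  ncard [set class_orbit (conj_class h) | h in
    [set h | h \in H /\ rk h = a_inv]].

End Invariants.

(* Main.v *)
From HB Require Import structures.
Require Import Defs.
From mathcomp Require Import all_boot all_order all_algebra all_fingroup all_field.
From mathcomp Require Import finmap all_classical all_reals all_analysis.
From mathcomp Require Import zify ring lra.
Import Order.TTheory GRing.Theory Num.Theory.
Import numFieldNormedType.Exports.

Set Implicit Arguments.
Unset Strict Implicit.
Unset Printing Implicit Defensive.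

Local Open Scope classical_set_scope.
Local Open Scope ring_scope.

(** Tori are sorted by the conjugacy class in GL_n(Z) of their Galois image, and
    the hypothesis is summed over these classes. Four facts make this work.

    There are finitely many classes of finite subgroups of GL_n(Z)
    ([finite_subgroup_classes]). A finite subgroup H preserves a norm on Z^n,
    and rescaling the norm on an invariant complement of the span of its
    minimal vectors, as often as needed, gives an invariant norm whose minimal
    vectors span Q^n ([exists_well_rounded_norm]). A basis V of Q^n made of
    minimal vectors generates a sublattice whose index is bounded in terms of n,
    by Dirichlet's pigeonhole argument; if moreover its determinant is maximal,
    Cramer's rule bounds the matrices of H in this basis. These matrices,
    together with V modulo the bound on the index, determine H up to
    conjugation, and only finitely many values are possible.

    No class grows faster than X (log X)^(n-1), and at least one grows this
    fast. Always a(H) >= 1, and when a(H) = 1 the elements counted by b(H) are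
    reflections ([rank1_is_reflection]). Roots of minimal height, one for each
    conjugacy class of reflections, form pairwise obtuse angles and lie in an
    open half-space, so they are linearly independent and b(H) <= n
    ([b_inv_le]). The diagonal group of signs has a = 1 and b = n
    ([sign_group_b_inv]).

    The class of the Galois image is an invariant of the isomorphism class of
    the torus. Regular functions on G_m^n are Laurent polynomials, so by
    Dedekind's independence of characters the characters of G_m^n are the
    monomials, and the character group of a torus has a basis of n elements
    ([torus_char_basis]). The Galois image in such a basis is finite because a
    character involves finitely many algebraic numbers. A change of basis
    conjugates it ([gal_image_basis_change]) and an isomorphism over Q
    transports it ([isom_gal_image]).

    The trivial class, which the hypothesis does not cover, contains at most one
    torus up to isomorphism ([trivial_gal_image_iso_class]): if Galois fixes all
    characters then an isomorphism with G_m^n commutes with Galois, and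
    averaging its coefficients over their conjugates defines it over Q.

    So the number of tori is a finite sum of counting functions, those of order
    X (log X)^(n-1) contribute their positive constants, and the others are
    negligible ([asymp_equiv_cvg]). *)

Local Notation "x %:rat" := (map_mx (intr : int -> rat) x) (at level 2, format "x %:rat").
Local Notation GQ := {rmorphism algC -> algC}.
Local Notation pQtoC := (map_poly (ratr : rat -> algC)).

(** * Invariant norms on the lattice and their minimal vectors *)

Lemma invmx_mul (R : comUnitRingType) n (A B : 'M[R]_n) :
  A \in unitmx -> B \in unitmx -> invmx (A *m B) = invmx B *m invmx A.
Proof.
move=> uA uB; have uAB : A *m B \in unitmx by rewrite unitmx_mul uA.
by rewrite -[RHS](mulmxK uAB) -!mulmxA (mulKmx uA) (mulKmx uB).
Qed.

Section FiniteSubgroups.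
Variable n : nat.
Implicit Types (H : {fset 'M[int]_n}) (N : 'rV[int]_n -> nat) (V W : 'M[int]_n).

(** Norms on the lattice itself, with values in nat, so that a vector of least
    norm exists by well-ordering. The group acts on row vectors. *)
Record invariant_norm H N : Prop := InvariantNorm {
  norm_add : forall x y, (N (x + y)%R <= N x + N y)%N;
  norm_scale : forall a x, N (a *: x) = (`|a| * N x)%N;
  norm_eq0 : forall x, N x = 0%N -> x = 0;
  norm_act : forall x h, h \in H -> N (x *m h) = N x }.

Definition minvec N x := x != 0 /\ forall y, y != 0 -> (N x <= N y)%N.

Lemma norm0 H N : invariant_norm H N -> N 0 = 0%N.
Proof. by move=> NH; rewrite -(scale0r 0) (norm_scale NH). Qed.

Lemma norm_sum H N (I : finType) (F : I -> 'rV[int]_n) : invariant_norm H N ->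
  (N (\sum_i F i)%R <= \sum_i N (F i))%N.
Proof.
move=> NH; elim/big_ind2: _ => [|x a y b xa yb|//]; first by rewrite (norm0 NH).
exact: leq_trans (norm_add NH _ _) (leq_add xa yb).
Qed.

Lemma fset_reindex H (f : 'M[int]_n -> 'M[int]_n) (A : nmodType) (F : 'M[int]_n -> A) :
  {in H, forall h, f h \in H} -> injective f -> \sum_(h <- H) F (f h) = \sum_(h <- H) F h.
Proof.
move=> fH finj; rewrite -(big_map f xpredT F); apply: perm_big.
have fu : uniq (map f H) by rewrite map_inj_uniq ?fset_uniq.
have fsub : {subset map f H <= H} by move=> _ /mapP[h hH ->]; exact: fH.
have [|_ fE] := uniq_min_size fu fsub; first by rewrite size_map.
by apply: uniq_perm; rewrite ?fset_uniq.
Qed.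

Lemma subgroup_reindex H (g : 'M[int]_n) (A : nmodType) (F : 'M[int]_n -> A) :
  finite_subgroup H -> g \in H -> \sum_(h <- H) F (h *m g) = \sum_(h <- H) F h.
Proof.
move=> [H1 HV HM] gH; have [gu _] := HV _ gH.
apply: fset_reindex => [h hH|]; first exact: HM.
exact: can_inj (mulmxK gu).
Qed.

Lemma subgroup_reindexl H (g : 'M[int]_n) (A : nmodType) (F : 'M[int]_n -> A) :
  finite_subgroup H -> g \in H -> \sum_(h <- H) F (g *m h) = \sum_(h <- H) F h.
Proof.
move=> [H1 HV HM] gH; have [gu _] := HV _ gH.
apply: fset_reindex => [h hH|]; first exact: HM.
exact: can_inj (mulKmx gu).
Qed.

Lemma exists_invariant_norm H : finite_subgroup H -> exists N, invariant_norm H N.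
Proof.
move=> [H1 HV HM].
exists (fun x : 'rV_n => \max_(h <- H) \max_i `|(x *m h) 0%R i|)%N.
have le_coord (x : 'rV_n) h i : h \in H ->
    (`|(x *m h) 0%R i| <= \max_(h <- H) \max_i `|(x *m h) 0%R i|)%N.
  move=> hH; apply: leq_trans (leq_bigmax_seq _ hH isT).
  exact: (leq_bigmax (F := fun i => `|(x *m h) 0%R i|%N)).
have le_norm x k : (forall h i, h \in H -> `|(x *m h) 0%R i| <= k)%N ->
    (\max_(h <- H) \max_i `|(x *m h) 0%R i| <= k)%N.
  by move=> xk; apply/bigmax_leqP_seq => h hH _; apply/bigmax_leqP => i _; apply: xk.
have le_act (x : 'rV_n) h : h \in H -> (\max_(k <- H) \max_i `|(x *m h *m k) 0%R i|
    <= \max_(k <- H) \max_i `|(x *m k) 0%R i|)%N.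
  by move=> hH; apply: le_norm => k i kH; rewrite -mulmxA; apply/le_coord/HM.
split=> [x y|a x|x|x h hH].
- apply: le_norm => h i hH; rewrite mulmxDl mxE.
  have tri (a b : int) : (`|(a + b)%R| <= `|a| + `|b|)%N by lia.
  exact: leq_trans (tri _ _) (leq_add (le_coord x h i hH) (le_coord y h i hH)).
- rewrite big_distrr /=; apply: eq_bigr => h _; rewrite big_distrr /=.
  by apply: eq_bigr => i _; rewrite -scalemxAl mxE abszM.
- move=> x0; apply/rowP => i; have := le_coord x _ i H1.
  by rewrite x0 mulmx1 leqn0 absz_eq0 mxE => /eqP.
- apply/eqP; rewrite eqn_leq le_act //=.
  have [hu hVH] := HV _ hH; have := le_act (x *m h) _ hVH.
  by rewrite mulmxK.
Qed.

Lemma clear_denominators (A : 'M[rat]_n) :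
  exists2 d : int, d != 0 & exists Z : 'M[int]_n, Z%:rat = d%:~R *: A.
Proof.
pose d : int := \prod_i \prod_j denq (A i j).
have d0 : d != 0.
  by apply/prodf_neq0 => i _; apply/prodf_neq0 => j _; exact: denq_neq0.
exists d => //.
have /fin_all_exists[Z Zd] (ij : 'I_n * 'I_n) :
    exists z : int, z%:~R = d%:~R * A ij.1 ij.2 :> rat.
  case: ij => i j /=.
  have [u ->] : exists u, d = denq (A i j) * u.
    by rewrite /d (bigD1 i) //= (bigD1 j) //= -mulrA; eexists.
  exists (numq (A i j) * u).
  by rewrite !rmorphM /= numqE; ring.
by exists (\matrix_(i, j) Z (i, j)); apply/matrixP => i j; rewrite !mxE (Zd (i, j)).
Qed.

Lemma ratmx_inj m k : injective (fun A : 'M[int]_(m, k) => A%:rat).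
Proof.
by move=> A B /matrixP AB; apply/matrixP => i j; have := AB i j; rewrite !mxE => /intr_inj.
Qed.

(** Maschke's averaging, with denominators cleared: P is p times a projection
    onto the row space of B. *)
Lemma equivariant_projection H k (B : 'M[int]_(k, n)) : finite_subgroup H ->
  (forall h, h \in H -> (B%:rat *m h%:rat <= B%:rat)%MS) ->
  exists2 p : int, p != 0 & exists P : 'M[int]_n,
    [/\ (P%:rat <= B%:rat)%MS,
        forall x : 'rV_n, (x%:rat <= B%:rat)%MS -> x *m P = p *: x
      & forall h, h \in H -> h *m P = P *m h].
Proof.
move=> HG BH; have [H1 HV HM] := HG.
set U := B%:rat in BH *.
(* A Q-linear projection onto U, to be averaged over the group. *)
have [Q QU] : exists Q, forall x : 'rV_n, (x <= U)%MS -> x *m Q *m U = x.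
  by exists (pinvmx U) => x xU; rewrite mulmxKpV.
have [d d0 [Z Zd]] := clear_denominators (Q *m U).
exists (d * #|` H|%:Z).
  rewrite mulf_neq0 // -[0]/(0%N%:Z) eqz_nat -lt0n cardfs_gt0.
  by apply/fset0Pn; exists 1%:M.
exists (\sum_(h <- H) invmx h *m Z *m h); split.
- rewrite map_mx_sum big_seq; elim/big_ind: _ => [|A C AU CU|h hH].
  + exact: sub0mx.
  + exact: addmx_sub.
  + rewrite !map_mxM Zd -scalemxAr -!scalemxAl scalemx_sub //.
    by rewrite !mulmxA -(mulmxA _ U) mulmx_sub //; exact: BH.
- move=> x xU; have [y xy] := submxP xU.
  apply: ratmx_inj; rewrite map_mxM map_mx_sum map_mxZ mulmx_sumr.
  rewrite (eq_big_seq (fun=> d%:~R *: x%:rat)) => [|h hH] /=.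
    by rewrite big_const_seq count_predT iter_addr_0 -scaler_nat scalerA rmorphM /= mulrC.
  have [hu hVH] := HV _ hH; rewrite !map_mxM Zd -scalemxAr -!scalemxAl -scalemxAr.
  congr (_ *: _); rewrite !mulmxA QU.
    by rewrite -mulmxA -map_mxM mulVmx // map_mx1 mulmx1.
  by rewrite xy -mulmxA mulmx_sub //; exact: BH.
- move=> g gH; rewrite mulmx_sumr mulmx_suml.
  rewrite -(subgroup_reindex (fun h => g *m (invmx h *m Z *m h)) HG gH) big_seq [RHS]big_seq.
  apply: eq_bigr => h hH; have [hu _] := HV _ hH; have [gu _] := HV _ gH.
  by rewrite invmx_mul // !mulmxA mulmxV // mul1mx.
Qed.

Lemma minvec_act H N x h : finite_subgroup H -> invariant_norm H N -> h \in H ->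
  minvec N x -> minvec N (x *m h).
Proof.
move=> [_ HV _] NH hH [x0 xmin]; have [hu _] := HV _ hH.
split; last by move=> y /xmin; rewrite (norm_act NH).
by apply: contraNneq x0 => xh0; rewrite -(mulmxK hu x) xh0 mul0mx.
Qed.

Lemma minvec_gt0 H N x : invariant_norm H N -> minvec N x -> (0 < N x)%N.
Proof. by move=> NH [x0 _]; rewrite lt0n; apply: contra_neq x0; exact: (norm_eq0 NH). Qed.

Lemma exists_minvec N (y : 'rV[int]_n) : y != 0 -> exists x, minvec N x.
Proof.
move=> y0.
have /ex_minnP[v /asboolP[x x0 <-] vmin] : exists v, `[< exists2 x, x != 0 & N x = v >].
  by exists (N y); apply/asboolP; exists y.
by exists x; split=> // z z0; apply: vmin; apply/asboolP; exists z.
Qed.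

(** Let U be the span of the minimal vectors, and U' an invariant complement.
    Keep the norm on U and rescale it on U' by the factor for which the shortest
    vectors outside U have the same length as the old minimal vectors: those
    stay minimal, and a vector outside U becomes minimal too. *)
Lemma enlarge_minvec_span H N k (B : 'M[int]_(k, n)) :
  finite_subgroup H -> invariant_norm H N -> (forall i, minvec N (row i B)) ->
  (forall x, minvec N x -> (x%:rat <= B%:rat)%MS) -> ~~ row_full B%:rat ->
  exists N' x, [/\ invariant_norm H N', forall i, minvec N' (row i B),
    minvec N' x & ~~ (x%:rat <= B%:rat)%MS].
Proof.
move=> HG NH Bmin BS; rewrite -sub1mx => /row_subPn[i0 xU]; set U := B%:rat in BS xU *.
have {xU} [x xU] : exists x : 'rV[int]_n, ~~ (x%:rat <= U)%MS.
  by exists (row i0 1%:M); rewrite map_row map_mx1.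
have [p p0 [P [PU Pu Ph]]] : exists2 p : int, p != 0 & exists P : 'M[int]_n,
    [/\ (P%:rat <= U)%MS, forall x : 'rV_n, (x%:rat <= U)%MS -> x *m P = p *: x
      & forall h, h \in H -> h *m P = P *m h].
  apply: equivariant_projection => // h hH; apply/row_subP => i.
  rewrite row_mul -map_row -map_mxM; apply: BS.
  exact: (minvec_act HG NH hH (Bmin i)).
have PxU (y : 'rV_n) : ((y *m P)%:rat <= U)%MS by rewrite map_mxM mulmx_sub.
pose P2 := p%:M - P.
have P2E (y : 'rV_n) : y *m P2 = p *: y - y *m P by rewrite mulmxBr mul_mx_scalar.
have P2h h : h \in H -> h *m P2 = P2 *m h.
  by move=> hH; rewrite mulmxBr mulmxBl Ph // scalar_mxC.
have pU (y : 'rV_n) : ((p *: y)%:rat <= U)%MS = (y%:rat <= U)%MS.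
  by rewrite map_mxZ eqmx_scale ?intr_eq0.
have x0 : x != 0 by apply: contraNneq xU => ->; rewrite map_mx0 sub0mx.
have [m0 m0min] := exists_minvec N x0.
pose m := N m0.
have mE y : minvec N y -> N y = m.
  case: m0min => m00 m0min [y0 ymin]; apply/eqP.
  by rewrite eqn_leq ymin // m0min.
have m_gt0 : (0 < m)%N by exact: (minvec_gt0 NH m0min).
have p_gt0 : (0 < `|p|)%N by rewrite absz_gt0.
(* Only vectors whose U-component is not longer than a minimal vector can become
   too short; mu is the least transverse length among them. *)
have /ex_minnP[_ /asboolP[y [yU yP <-]] mu_min] : exists v, `[< exists y,
    [/\ ~~ (y%:rat <= U)%MS, (N (y *m P) <= `|p| * m)%N & N (y *m P2) = v] >].
  exists (N (x *m P2 *m P2)); apply/asboolP; exists (x *m P2); split=> //.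
    apply: contraNN xU => xP2U; rewrite -pU -(subrK (x *m P) (p *: x)) -P2E.
    by rewrite map_mxD addmx_sub.
  by rewrite P2E mulmxBl -scalemxAl (Pu _ (PxU x)) subrr (norm0 NH).
set mu := N (y *m P2) in mu_min.
have mu_gt0 : (0 < mu)%N.
  rewrite lt0n; apply: contraNneq yU => /(norm_eq0 NH)/eqP.
  by rewrite P2E subr_eq0 -pU => /eqP ->.
(* With these factors the transverse component of y is as long as the rescaled
   minimal vectors of U. *)
pose N' z := maxn (mu * N (z *m P)) (`|p| * m * N (z *m P2)).
have N'le z : z != 0 -> (mu * (`|p| * m) <= N' z)%N.
  move=> z0; rewrite leq_max.
  have [zU|zU] := boolP (z%:rat <= U)%MS.
    rewrite Pu // (norm_scale NH) !leq_pmul2l //.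
    by case: m0min => _ ->.
  case: (leqP (N (z *m P)) (`|p| * m)) => [zP|/ltnW zP]; last first.
    by rewrite leq_pmul2l // zP.
  apply/orP; right; rewrite mulnC leq_pmul2l ?muln_gt0 ?p_gt0 // mu_min //.
  by apply/asboolP; exists z.
have N'min z : z != 0 -> (N' z <= mu * (`|p| * m))%N -> minvec N' z.
  by move=> z0 zle; split=> // t /N'le; apply: leq_trans.
exists N', y; split=> //.
- split=> [z t|a z|z|z h hH].
  + rewrite /N' !mulmxDl geq_max; apply/andP; split.
      apply: leq_trans (leq_mul (leqnn _) (norm_add NH _ _)) _.
      by rewrite mulnDr leq_add // leq_max leqnn.
    apply: leq_trans (leq_mul (leqnn _) (norm_add NH _ _)) _.
    by rewrite mulnDr leq_add // leq_max leqnn orbT.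
  + by rewrite /N' -!scalemxAl !(norm_scale NH) maxnMr ![(`|a| * (_ * _))%N]mulnCA.
  + move=> /eqP; rewrite -leqn0 geq_max !leqn0 !muln_eq0.
    rewrite (gtn_eqF mu_gt0) (gtn_eqF p_gt0) (gtn_eqF m_gt0) /= => /andP[/eqP/(norm_eq0 NH) zP /eqP/(norm_eq0 NH)].
    by rewrite P2E zP subr0 => /eqP; rewrite scalemx_eq0 (negbTE p0) => /eqP.
  + by rewrite /N' -!mulmxA Ph // P2h // !mulmxA !(norm_act NH _ hH).
- move=> i; have [b0 _] := Bmin i; have bU := BS _ (Bmin i); apply: N'min => //.
  by rewrite /N' P2E Pu // subrr (norm0 NH) muln0 maxn0 (norm_scale NH) mE.
- apply: N'min; first by apply: contraNneq yU => ->; rewrite map_mx0 sub0mx.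
  by rewrite /N' geq_max leq_mul //= mulnC.
Qed.

(** * Finiteness of the classes of finite subgroups *)

(** Among all invariant norms and all families of minimal vectors of them, take
    a family of maximal rank: it has rank n, or it could be enlarged. *)
Lemma exists_well_rounded_norm H : finite_subgroup H ->
  exists N V, [/\ invariant_norm H N, forall i, minvec N (row i V) & \det V != 0].
Proof.
move=> HG.
pose achieved r := `[< exists N k (B : 'M[int]_(k, n)), [/\ invariant_norm H N,
  forall i, minvec N (row i B) & \rank B%:rat = r] >].
have ach0 : exists r, achieved r.
  have [N NH] := exists_invariant_norm HG.
  exists (\rank (0 : 'M[int]_(0, n))%:rat); apply/asboolP.
  by exists N, 0%N, 0; split=> // -[].
have ach_le r : achieved r -> (r <= n)%N.
  by move=> /asboolP[N [k [B [_ _ <-]]]]; exact: rank_leq_col.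
have [r /asboolP[N [k [B [NH Bmin <-]]]] rmax] := ex_maxnP ach0 ach_le.
have inB N' x : invariant_norm H N' -> (forall i, minvec N' (row i B)) ->
    minvec N' x -> (x%:rat <= B%:rat)%MS.
  move=> N'H B' xmin; apply: contraT => xB.
  have : (\rank B%:rat < \rank (col_mx x B)%:rat)%N.
    rewrite rank_ltmx // map_col_mx /ltmx col_mx_sub (negbTE xB) andbT.
    by apply: submx_trans (addsmxSr x%:rat _) _; rewrite addsmxE.
  rewrite ltnNge rmax //; apply/asboolP; exists N', _, (col_mx x B); split=> // i.
  by have [j ->|j ->] := split_ordP i; rewrite ?rowKu ?rowKd // row_id.
have Bfull : row_full B%:rat.
  apply: contraT => Bnfull.
  have [|N' [x [N'H B' xmin]]] := enlarge_minvec_span HG NH Bmin _ Bnfull.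
    by move=> x; exact: inB.
  by rewrite (inB N').
exists N, (rowsub (fullrankfun Bfull) B); split=> // [i|].
  by rewrite row_rowsub.
have := fullrowsub_unit Bfull; rewrite unitmxE -map_mxsub det_map_mx unitfE.
by rewrite intr_eq0.
Qed.

(** A number divisible by every positive integer up to (n+1)^n, the number of
    boxes in the pigeonhole argument below. *)
Definition index_bound : nat := ((n.+1 ^ n)`!)%N.
Local Notation M := (index_bound%:Z).

Lemma equal_floor_dist (m d r s : nat) : (0 < d)%N -> (m * r %/ d = m * s %/ d)%N ->
  (m * `|r%:Z - s%:Z| <= d)%N.
Proof.
move=> d0 e; have := divn_eq (m * r) d; have := divn_eq (m * s) d; rewrite e.
have := ltn_pmod (m * r) d0; have := ltn_pmod (m * s) d0.
move: (_ * s %/ d * d)%N (_ %% d)%N (_ %% d)%N => q a b; nia.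
Qed.

(** Cut the fundamental parallelepiped of V into (n+1)^n equal boxes. Two of the
    first (n+1)^n + 1 multiples of x fall in the same box modulo the lattice of
    V, and their difference is then too short to be nonzero. *)
Lemma minvec_dirichlet H N V (x : 'rV[int]_n) : invariant_norm H N ->
  (forall i, minvec N (row i V)) -> \det V != 0 ->
  exists z : 'rV[int]_n, M *: x = z *m V.
Proof.
move=> NH Vmin D0; set D := \det V in D0.
have d_gt0 : (0 < `|D|)%N by rewrite absz_gt0.
have [cv cvE] : exists cv, cv = x *m \adj V by exists (x *m \adj V).
pose c i : int := cv 0 i; pose K := (n.+1 ^ n)%N.
(* The coordinates of k x in the basis V are k c / D; rem k is the numerator of
   their fractional parts. *)
pose rem (k : 'I_K.+1) i := `|(k%:Z * c i %% D)%Z|%N.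
have rem_lt k i : (rem k i < `|D|)%N.
  by rewrite /rem; have := modz_ge0 (k%:Z * c i) D0; have := ltz_mod (k%:Z * c i) D0; lia.
pose box k := [ffun i => inord (n.+1 * rem k i %/ `|D|) : 'I_n.+1].
have : ~~ injectiveb box.
  apply/injectiveP => /leq_card; rewrite card_ffun !card_ord.
  by rewrite ltnn.
move=> /injectivePn[k1 [k2 k12 /ffunP box12]].
pose q : int := k1%:Z - k2%:Z.
have q0 : q != 0 by rewrite subr_eq0 eqz_nat.
have qK : (`|q| <= K)%N by have := ltn_ord k1; have := ltn_ord k2; rewrite /q; lia.
pose z := \row_i ((k1%:Z * c i %/ D)%Z - (k2%:Z * c i %/ D)%Z).
pose y := q *: x - z *m V.
pose rho := \row_i ((rem k1 i)%:Z - (rem k2 i)%:Z).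
have remE k i : (rem k i)%:Z = k%:Z * c i - (k%:Z * c i %/ D)%Z * D.
  by rewrite /rem gez0_abs ?modz_ge0.
have Dy : D *: y = rho *m V.
  have -> : rho = q *: cv - D *: z.
    by apply/rowP => i; rewrite !mxE !remE /q /c; ring.
  rewrite mulmxBl -!scalemxAl cvE -mulmxA mul_adj_mx mul_mx_scalar.
  by rewrite /y scalerBr !scalerA mulrC.
have y0 : y = 0.
  apply: contraTeq isT => yn0.
  have Ny : (0 < N y)%N by rewrite lt0n; apply: contra_neq yn0; exact: (norm_eq0 NH).
  suff : (n.+1 * (`|D| * N y) <= n * (`|D| * N y))%N.
    by rewrite leq_pmul2r ?muln_gt0 ?d_gt0 // ltnn.
  rewrite -[X in (_ * X <= _)%N](norm_scale NH) Dy mulmx_sum_row.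
  apply: leq_trans (leq_mul (leqnn _) (norm_sum _ NH)) _.
  rewrite big_distrr /= -[X in (_ <= X * _)%N]card_ord -sum_nat_const leq_sum // => i _.
  rewrite (norm_scale NH) mulnA leq_mul //; last by have [_] := Vmin i; apply.
  rewrite mxE equal_floor_dist //.
  have := box12 i; rewrite !ffunE => /(congr1 val); rewrite /= !inordK //.
    by rewrite ltn_divLR // ltn_pmul2l.
  by rewrite ltn_divLR // ltn_pmul2l.
have [u Mu] : exists u, M = u * q.
  have /dvdnP[v] : (`|q| %| index_bound)%N by rewrite dvdn_fact // absz_gt0 q0 qK.
  rewrite /index_bound => ->; exists (v%:Z * Num.sg q).
  by rewrite PoszM -mulrA abszE normrEsg.
exists (u *: z); rewrite -scalemxAl Mu -scalerA; congr (_ *: _).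
by apply/eqP; rewrite -subr_eq0 -/y y0.
Qed.

Lemma minvec_basis_index H N V : invariant_norm H N ->
  (forall i, minvec N (row i V)) -> \det V != 0 -> exists W, W *m V = M%:M.
Proof.
move=> NH Vmin D0.
have /fin_all_exists[w wE] i := minvec_dirichlet (row i 1%:M) NH Vmin D0.
exists (\matrix_i w i); apply/row_matrixP => i.
by rewrite row_mul rowK -wE; apply/rowP => j; rewrite !mxE mulr_natr.
Qed.

Lemma index_bound_gt0 : (0 < index_bound)%N.
Proof. exact: fact_gt0. Qed.

Lemma mulmx_lcancel k V (X Y : 'M[int]_(n, k)) : \det V != 0 -> V *m X = V *m Y -> X = Y.
Proof.
move=> D0 /(congr1 (mulmx (\adj V))); rewrite !mulmxA mul_adj_mx !mul_scalar_mx.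
move=> /matrixP XY; apply/matrixP => i j; apply: (mulfI D0).
by have := XY i j; rewrite !mxE.
Qed.

Lemma mulmx_rcancel k V (X Y : 'M[int]_(k, n)) : \det V != 0 -> X *m V = Y *m V -> X = Y.
Proof.
move=> D0 /(congr1 trmx); rewrite !trmx_mul => /mulmx_lcancel XY.
by apply: trmx_inj; apply: XY; rewrite det_tr.
Qed.

Lemma scalar_inv_det V W (a : int) : a != 0 -> W *m V = a%:M -> \det W != 0.
Proof.
move=> a0 /(congr1 determinant); rewrite det_mulmx det_scalar => DWV.
by apply: contraNneq (expf_neq0 n a0) => DW; rewrite -DWV DW mul0r.
Qed.

Lemma scalar_inv_comm V W (a : int) : a != 0 -> W *m V = a%:M -> V *m W = a%:M.
Proof.
move=> a0 WV; apply: (mulmx_lcancel (scalar_inv_det a0 WV)).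
by rewrite mulmxA WV scalar_mxC.
Qed.

(** Cramer's rule. *)
Lemma det_replace_row V (x : 'rV[int]_n) j :
  \det (\matrix_(a, b) if a == j then x 0 b else V a b) = (x *m \adj V) 0 j.
Proof.
rewrite (expand_det_row _ j) mxE; apply: eq_bigr => b _; rewrite !mxE eqxx.
congr (_ * _); rewrite /cofactor; congr (_ * \det _).
by apply/matrixP => a c; rewrite !mxE eq_sym (negbTE (neq_lift _ _)).
Qed.

Let M0 : M != 0.
Proof. by rewrite eqz_nat -lt0n index_bound_gt0. Qed.

(** Choose V of maximal determinant among the bases of Q^n made of minimal
    vectors. The images of its rows under H are again minimal vectors, so by
    Cramer's rule their coordinates are quotients of determinants of absolute
    value at most 1. *)
Lemma exists_reduced_basis H : finite_subgroup H ->
  exists V W, [/\ V *m W = M%:M, W *m V = M%:M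
    & forall h, h \in H -> forall i j, (`|(V *m h *m W) i j| <= index_bound)%N].
Proof.
move=> HG; have [N [V0 [NH V0min D0]]] := exists_well_rounded_norm HG.
pose good V := (forall i, minvec N (row i V)) /\ \det V != 0.
have good_le V : good V -> (`|\det V| <= index_bound ^ n)%N.
  move=> [Vmin D]; have [W WV] := minvec_basis_index NH Vmin D.
  move: (scalar_inv_det M0 WV) (congr1 determinant WV).
  rewrite det_mulmx det_scalar => DW /(congr1 absz); rewrite abszM abszX absz_nat => <-.
  by rewrite leq_pmull // absz_gt0.
have [||d /asboolP[V [Vmin D] Vd] dmax] :=
    @ex_maxnP (fun d => `[< exists2 V, good V & `|\det V|%N = d >]) (index_bound ^ n)%N.
- by exists `|\det V0|%N; apply/asboolP; exists V0.
- by move=> d /asboolP[V /good_le Vle <-].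
have [W WV] := minvec_basis_index NH Vmin D.
exists V, W; split=> [|//|h hH i j]; first exact: scalar_inv_comm WV.
have DW : \det V *: W = M *: \adj V.
  by rewrite -mul_mx_scalar -mul_mx_adj mulmxA WV mul_scalar_mx.
have DC : \det V * (V *m h *m W) i j = M * (V *m h *m \adj V) i j.
  have := congr1 (fun A => (V *m h *m A) i j) DW.
  by rewrite /= -!scalemxAr mxE [in RHS]mxE.
have xmin : minvec N (row i V *m h) by exact: (minvec_act HG NH hH (Vmin i)).
have le_det : (`|(V *m h *m \adj V) i j| <= `|\det V|)%N.
  have -> : (V *m h *m \adj V) i j = (row i V *m h *m \adj V) 0 j.
    by rewrite -!row_mul [RHS]mxE.
  rewrite -det_replace_row; set V' := \matrix_(_, _) _.
  have [->//|D'] := eqVneq (\det V') 0.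
  rewrite Vd dmax //; apply/asboolP; exists V' => //; split=> // a.
  have [->|aj] := eqVneq a j.
    by rewrite (_ : row j V' = row i V *m h) //; apply/rowP => b; rewrite [LHS]mxE mxE eqxx.
  rewrite (_ : row a V' = row a V) //.
  by apply/rowP => b; rewrite !mxE (negbTE aj).
have D_gt0 : (0 < `|\det V|)%N by rewrite absz_gt0.
rewrite -(leq_pmul2l D_gt0) -abszM DC abszM absz_nat mulnC.
by rewrite leq_mul.
Qed.

(** The congruence V' = V mod M makes V^-1 V' and its inverse integral, because
    M V^-1 = W and M V'^-1 = W' are. *)
Lemma congruent_bases_conj H H' V W V' W' (X : 'M[int]_n) :
  V *m W = M%:M -> W *m V = M%:M -> V' *m W' = M%:M -> W' *m V' = M%:M ->
  V' = V + M *: X ->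
  [set V *m h *m W | h in [set` H]] = [set V' *m h *m W' | h in [set` H']] ->
  conj_GLnZ [set` H] [set` H'].
Proof.
move=> VW WV VW' WV' VX HH'.
have DV := scalar_inv_det M0 VW; have DV' := scalar_inv_det M0 VW'.
have DW := scalar_inv_det M0 WV; have DW' := scalar_inv_det M0 WV'.
pose g := 1%:M + W *m X; pose g' := 1%:M - W' *m X.
have Vg : V *m g = V' by rewrite mulmxDr mulmx1 mulmxA VW mul_scalar_mx VX.
have Vg' : V' *m g' = V.
  by rewrite mulmxBr mulmx1 mulmxA VW' mul_scalar_mx VX addrK.
have gg' : g *m g' = 1%:M by apply: (mulmx_lcancel DV); rewrite mulmxA Vg Vg' mulmx1.
have [ug ug'] := mulmx1_unit gg'.
have gV : invmx g = g'.
  by rewrite -[RHS](mulKmx ug) gg' mulmx1.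
have gW' : g *m W' = W.
  by apply: (mulmx_lcancel DV); rewrite mulmxA Vg VW VW'.
have Wg' : W' = g' *m W by rewrite -gV -gW' mulKmx.
exists g => //; rewrite gV.
have conjE h h' : V *m h *m W = V' *m h' *m W' <-> h = g *m h' *m g'.
  rewrite -Vg Wg' !mulmxA; split=> [/(mulmx_rcancel DW)|->]; last by rewrite !mulmxA.
  by rewrite -!mulmxA => /(mulmx_lcancel DV); rewrite mulmxA.
apply/seteqP; split=> [h hH|_ [h' h'H <-]].
  have : [set V *m h *m W | h in [set` H]] (V *m h *m W) by exists h.
  by rewrite HH' => -[h' h'H /esym/conjE ->]; exists h'.
have : [set V' *m h *m W' | h in [set` H']] (V' *m h' *m W') by exists h'.
by rewrite -HH' => -[h hH /conjE <-].
Qed.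

(** A subgroup is determined up to conjugation by V mod M and by the set of its
    matrices V h W; both range over finite sets. *)
Theorem finite_subgroup_classes : exists l : seq {fset 'M[int]_n},
  (forall H, H \in l -> finite_subgroup H) /\
  forall H, finite_subgroup H -> exists2 H', H' \in l & conj_GLnZ [set` H] [set` H'].
Proof.
pose K := (index_bound + index_bound).+1.
pose F := ('M['I_K]_n * {set 'M['I_K]_n})%type.
(* Integer matrices with entries in [-M, M], as matrices over a finite type. *)
pose shift (c : 'M['I_K]_n) : 'M[int]_n := \matrix_(i, j) ((c i j : nat)%:Z - M).
have shift_onto (C : 'M[int]_n) : (forall i j, (`|C i j| <= index_bound)%N) ->
    exists c, shift c = C.
  move=> Cle; exists (\matrix_(i, j) inord `|(C i j + M)%R|%N).
  apply/matrixP => i j; rewrite !mxE inordK; first by have := Cle i j; lia.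
  by have := Cle i j; rewrite /K; lia.
pose key H (f : F) := finite_subgroup H /\ exists V W X,
  [/\ V *m W = M%:M, W *m V = M%:M, V = shift f.1 + M *: X
    & [set V *m h *m W | h in [set` H]] = shift @` [set` f.2]].
have exkey H : finite_subgroup H -> exists f, key H f.
  move=> HG; have [V [W [VW WV HVW]]] := exists_reduced_basis HG.
  pose V0 : 'M[int]_n := \matrix_(i, j) (V i j %% M)%Z.
  have [f1 f1E] : exists c, shift c = V0.
    apply: shift_onto => i j; rewrite mxE.
    have := modz_ge0 (V i j) M0; have := ltz_mod (V i j) M0; lia.
  exists (f1, [set c | `[< exists2 h, h \in H & shift c = V *m h *m W >]]%SET); split=> //.
  exists V, W, (\matrix_(i, j) (V i j %/ M)%Z); split=> //.
    by rewrite f1E; apply/matrixP => i j; rewrite !mxE addrC mulrC -divz_eq.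
  apply/seteqP; split=> [_ [h hH <-]|_ [c cf <-]].
    have [c cE] := shift_onto _ (HVW _ hH).
    by exists c => //=; rewrite inE; apply/asboolP; exists h.
  by move: cf; rewrite /= inE => /asboolP[h hH ->]; exists h.
have keyconj H H' f : key H f -> key H' f -> conj_GLnZ [set` H] [set` H'].
  move=> [HG [V [W [X [VW WV VX HVW]]]]] [HG' [V' [W' [X' [VW' WV' VX' HVW']]]]].
  apply: (congruent_bases_conj (X := X' - X) VW WV VW' WV'); last by rewrite HVW.
  by rewrite VX VX' scalerBr -addrA; congr (_ + _); rewrite addrC subrK.
exists [seq xget [fset 1%:M]%fset (key^~ f) | f <- enum {: F} & `[< exists H, key H f >]].
split=> [H /mapP[f]|H /exkey[f Hf]].
  rewrite mem_filter => /andP[/asboolP[H0 H0f] _] ->.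
  by have [] := xgetPex [fset 1%:M]%fset (ex_intro (key^~ f) _ H0f).
exists (xget [fset 1%:M]%fset (key^~ f)).
  by apply: map_f; rewrite mem_filter mem_enum andbT; apply/asboolP; exists H.
exact: (keyconj _ _ f Hf (xgetPex [fset 1%:M]%fset (ex_intro (key^~ f) _ Hf))).
Qed.

End FiniteSubgroups.

(** * Conjugacy classes of reflections *)

(** A finite set of hyperplanes misses some point of the moment curve
    (1, t, t^2, ...), since a nonzero polynomial does not vanish everywhere. *)
Lemma generic_functional n (s : seq 'rV[rat]_n) : 0 \notin s ->
  exists w : 'cV[rat]_n, forall x, x \in s -> (x *m w) 0 0 != 0.
Proof.
move=> s0; pose p := \prod_(x <- s) rVpoly x.
have p0 : p != 0.
  rewrite prodf_seq_neq0; apply/allP => x xs /=.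
  by apply: contraNneq s0 => /(congr1 (@poly_rV _ n)); rewrite rVpolyK linear0 => <-.
have [t tp] : exists t, ~~ root p t.
  apply: contrapT => noroot.
  pose rs : seq rat := [seq i%:R | i <- iota 0 (size p)].
  have rs_uniq : uniq rs by rewrite map_inj_uniq ?iota_uniq //; exact: (mulrIn (oner_neq0 _)).
  have rs_root : all (root p) rs.
    by apply/allP => t _; apply: contrapT => /negP tp; apply: noroot; exists t.
  by have := max_poly_roots p0 rs_root rs_uniq; rewrite size_map size_iota ltnn.
exists (\col_i t ^+ i) => x xs.
apply: contraNneq tp => xt; rewrite /root horner_prod prodf_seq_eq0.
apply/hasP; exists x => //=; rewrite horner_poly; apply/eqP; rewrite -[RHS]xt [RHS]mxE; apply: eq_bigr => i _.
by rewrite !mxE insubT //= => iP; congr (x _ _ * _); apply: val_inj.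
Qed.

Section InvariantForm.
Variables (n : nat) (H : {fset 'M[int]_n}).
Hypothesis HG : finite_subgroup H.
Implicit Types x y b : 'rV[rat]_n.

Definition invform x y : rat :=
  \sum_(g <- H) \sum_i (x *m g%:rat) 0 i * (y *m g%:rat) 0 i.
Local Notation q := invform.

Lemma invformC x y : q x y = q y x.
Proof. by apply: eq_bigr => g _; apply: eq_bigr => i _; rewrite mulrC. Qed.

Lemma invformDl x y z : q (x + y) z = q x z + q y z.
Proof.
rewrite -big_split; apply: eq_bigr => g _; rewrite -big_split; apply: eq_bigr => i _ /=.
by rewrite mulmxDl mxE mulrDl.
Qed.

Lemma invformZl a x y : q (a *: x) y = a * q x y.
Proof.
rewrite mulr_sumr; apply: eq_bigr => g _; rewrite mulr_sumr; apply: eq_bigr => i _.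
by rewrite -scalemxAl mxE mulrA.
Qed.

Lemma invformDr x y z : q z (x + y) = q z x + q z y.
Proof. by rewrite ![q z _]invformC invformDl. Qed.

Lemma invformZr a x y : q y (a *: x) = a * q y x.
Proof. by rewrite ![q y _]invformC invformZl. Qed.

Lemma invform0l x : q 0 x = 0.
Proof. by rewrite -[in LHS](scale0r 0) invformZl mul0r. Qed.

Lemma invform_suml (I : finType) (F : I -> 'rV[rat]_n) y :
  q (\sum_i F i) y = \sum_i q (F i) y.
Proof.
by apply: (big_morph (q^~ y)) => [x z|]; [exact: invformDl|exact: invform0l].
Qed.

Lemma invform_gt0 x : x != 0 -> 0 < q x x.
Proof.
have ge0 g : g \in H -> 0 <= \sum_i (x *m g%:rat) 0 i * (x *m g%:rat) 0 i.
  by move=> _; apply: sumr_ge0 => i _; rewrite -expr2 sqr_ge0.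
move=> x0; rewrite lt0r /invform; apply/andP; split; last first.
  by rewrite big_seq; apply: sumr_ge0 => g; exact: ge0.
apply: contraNneq x0; rewrite big_seq => /eqP; rewrite psumr_eq0 // => /allP/(_ 1%:M).
have [-> _ _] := HG; rewrite /= => /(_ isT)/eqP; rewrite map_mx1 mulmx1.
move=> /psumr_eq0P x0; apply/eqP/rowP => i; rewrite mxE; apply/eqP.
by rewrite -sqrf_eq0 expr2 x0 // => j _; rewrite -expr2 sqr_ge0.
Qed.

Lemma invform_act h x y : h \in H -> q (x *m h%:rat) (y *m h%:rat) = q x y.
Proof.
move=> hH; rewrite -[RHS](subgroup_reindexl _ HG hH).
apply: eq_bigr => g _; apply: eq_bigr => i _.
by rewrite map_mxM !mulmxA.
Qed.

(** An isometry moving a single line negates it, for fixing it would force the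
    displacement x h - x to be orthogonal to the line and hence zero. *)
Lemma rank1_is_reflection h : h \in H -> rk h = 1%N ->
  exists2 b, b != 0 & forall x, x *m h%:rat = x - (2 * q x b / q b b) *: b.
Proof.
move=> hH; rewrite /rk map_mxB map_mx1; set A := _ - _ => rA.
have /rowV0Pn[b bA b0] : A != 0 by rewrite -mxrank_eq0 rA.
have Ab : (A <= b)%MS.
  by rewrite -(mxrank_leqif_sup bA) rA rank_rV b0.
have actE x : exists c, x *m h%:rat = x + c *: b.
  have /sub_rVP[c cE] : (x *m A <= b)%MS by exact: submx_trans (submxMl _ _) Ab.
  by exists c; rewrite -cE mulmxBr mulmx1 addrC subrK.
have qb := invform_gt0 b0.
have [l0 bh0] := actE b; have {l0 bh0} [l bh] : exists l, b *m h%:rat = l *: b.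
  by exists (1 + l0); rewrite bh0 scalerDl scale1r.
have l2 : l ^+ 2 = 1.
  have := invform_act b b hH; rewrite bh invformZl invformZr mulrA => /eqP.
  by rewrite -subr_eq0 -{2}[q b b]mul1r -mulrBl mulf_eq0 (gt_eqF qb) orbF subr_eq0 -expr2 => /eqP.
have := invform_act _ b hH; rewrite bh => qh.
have [l1|l1] : l = 1 \/ l = -1.
  by move/eqP: l2; rewrite sqrf_eq1 => /orP[]/eqP; [left|right].
- suff A0 : A = 0 by rewrite A0 mxrank0 in rA.
  apply/row_matrixP => i; rewrite row0.
  have [c cE] := actE (row i 1%:M); have := qh (row i 1%:M).
  rewrite cE l1 scale1r invformDl invformZl => /eqP.
  rewrite -[X in _ == X]addr0 (inj_eq (addrI _)) mulf_eq0 (gt_eqF qb) orbF => /eqP c0.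
  by rewrite rowE -rowE -[A]mul1mx row_mul mulmxBr mulmx1 cE c0 scale0r addr0 subrr.
exists b => // x; have [c cE] := actE x; rewrite cE; congr (x + _).
rewrite -scaleNr; congr (_ *: _); have := qh x.
rewrite cE l1 invformZr invformDl invformZl => e.
have : c * q b b = - (2 * q x b) by move: e; lra.
by move=> /(congr1 (fun z => z / q b b)) /=; rewrite mulfK ?gt_eqF // => ->; rewrite mulNr.
Qed.

(** A linear relation, split by the signs of its coefficients, equates two
    nonnegative combinations whose product is at most 0; both then vanish, and
    evaluating them on the positive functional kills every coefficient. *)
Lemma obtuse_independent k (beta : 'I_k -> 'rV[rat]_n) (w : 'cV[rat]_n) :
  (forall i, 0 < (beta i *m w) 0 0) ->
  (forall i j, i != j -> q (beta i) (beta j) <= 0) -> (k <= n)%N.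
Proof.
move=> bw bq; pose B := \matrix_i beta i.
suff /eqP <- : row_free B by exact: rank_leq_col.
apply: inj_row_free => v vB.
pose part (u : 'rV[rat]_k) := \sum_i Num.max (u 0 i) 0 *: beta i.
have maxrB (a : rat) : Num.max a 0 - Num.max (- a) 0 = a.
  have [a0|a0] := leP a 0; first by rewrite max_l ?oppr_ge0 // sub0r opprK.
  by rewrite max_r ?subr0 // oppr_le0 ltW.
have partE : part v = part (- v).
  apply/eqP; rewrite -subr_eq0 -sumrB -[X in _ == X]vB mulmx_sum_row; apply/eqP.
  by apply: eq_bigr => i _; rewrite rowK -scalerBl [(- v) 0 i]mxE maxrB.
have part0 : part v = 0.
  apply: contraTeq isT => /invform_gt0; rewrite ltNge {2}partE.
  suff -> : q (part v) (part (- v)) <= 0 by [].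
  rewrite invform_suml; apply: sumr_le0 => i _; rewrite invformC invform_suml.
  apply: sumr_le0 => j _; rewrite invformZl invformZr mulrA.
  have [->|ji] := eqVneq j i.
    have [vi|vi] := leP (v 0 i) 0; first by rewrite ?mulr0 ?mul0r // mulr0 mul0r.
    by rewrite mxE [Num.max (- _) 0]max_r ?mul0r // oppr_le0 ltW.
  by apply: mulr_ge0_le0; [rewrite mulr_ge0 // le_max lexx orbT|exact: bq].
have le0 u : part u = 0 -> forall i, u 0 i <= 0.
  move=> u0 i; have : (part u *m w) 0 0 = 0 by rewrite u0 mul0mx mxE.
  rewrite mulmx_suml summxE => /psumr_eq0P; move=> /(_ _ i isT).
  have ge0 j : 0 <= (Num.max (u 0 j) 0 *: beta j *m w) 0 0.
    by rewrite -scalemxAl mxE mulr_ge0 ?le_max ?lexx ?orbT // ltW.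
  move=> /(_ (fun j _ => ge0 j)); rewrite -scalemxAl mxE => /eqP.
  rewrite mulf_eq0 (gt_eqF (bw i)) orbF => /eqP m0.
  by rewrite -m0 le_max lexx.
apply/rowP => i; rewrite mxE; apply/eqP; rewrite eq_le le0 //=.
by have := le0 _ (etrans (esym partE) part0) i; rewrite mxE oppr_le0.
Qed.

(** Equality in Cauchy-Schwarz forces proportionality. *)
Lemma invform_colinear x y : y != 0 -> q x x * q y y <= q x y ^+ 2 ->
  q y y *: x = q x y *: y.
Proof.
move=> y0 le; apply/eqP; rewrite -subr_eq0; apply: contraTT le => /invform_gt0.
rewrite -scaleNr !(invformDl, invformDr, invformZl, invformZr) (invformC y x) -ltNge.
by have := invform_gt0 y0; nra.
Qed.

(** In each class take a root on which a generic functional is positive and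
    minimal: reflecting one of these roots in another cannot produce a smaller
    positive root, so two of them make an obtuse angle unless they coincide up
    to scaling. *)
Lemma reflection_classes_le k (h : 'I_k -> 'M[int]_n) :
  (forall i, h i \in H /\ rk (h i) = 1%N) ->
  (forall i j, i != j -> conj_class H (h i) <> conj_class H (h j)) -> (k <= n)%N.
Proof.
have [H1 HV HM] := HG.
move=> hH h_inj.
have /fin_all_exists2[b b0 bE] i : exists2 b, b != 0 &
    forall x, x *m (h i)%:rat = x - (2 * q x b / q b b) *: b.
  by have [hi ri] := hH i; exact: rank1_is_reflection.
have [w w0] : exists w : 'cV[rat]_n, forall i g, g \in H -> (b i *m g%:rat *m w) 0 0 != 0.
  have [|w wP] := @generic_functional n [seq b i *m g%:rat | i <- enum 'I_k, g <- H].
    apply/negP => /allpairsP[[i g] /= [_ gH /esym/eqP]].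
    apply/negP; apply: contraNneq (b0 i) => /(congr1 (mulmx^~ (invmx g)%:rat)) /=.
    by have [gu _] := HV _ gH; rewrite -mulmxA -map_mxM mulmxV // map_mx1 mulmx1 mul0mx => ->.
  by exists w => i g gH; apply: wP; apply/allpairsP; exists (i, g); rewrite /= mem_enum.
pose l (x : 'rV[rat]_n) := (x *m w) 0 0.
have lD x y : l (x + y) = l x + l y by rewrite /l mulmxDl mxE.
have lZ a x : l (a *: x) = a * l x by rewrite /l -scalemxAl mxE.
(* The root of h i of least positive height. *)
have /fin_all_exists[g gP] i : exists g, [/\ g \in H, 0 < l (b i *m g%:rat) &
    forall g', g' \in H -> 0 < l (b i *m g'%:rat) -> l (b i *m g%:rat) <= l (b i *m g'%:rat)].
  have [g0 g0H g0l] : exists2 g0, g0 \in H & 0 < l (b i *m g0%:rat).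
    have [hi ri] := hH i.
    have lb0 : l (b i) != 0 by have := w0 i _ H1; rewrite map_mx1 mulmx1.
    have [lb|lb] := ltP 0 (l (b i)).
      by exists 1%:M => //; rewrite map_mx1 mulmx1.
    exists (h i) => //; rewrite bE mulfK ?gt_eqF ?invform_gt0 //.
    by move: lb0 lb; rewrite -scaleNr lD lZ; lra.
  have [g glb gmin] := @arg_minP _ _ _ [` g0H]%fset (fun g : H => 0 < l (b i *m (val g)%:rat))
     (fun g : H => l (b i *m (val g)%:rat)) g0l.
  exists (val g); split=> //; first exact: valP.
  by move=> g' g'H; exact: (gmin [` g'H]%fset).
pose beta i := b i *m (g i)%:rat.
pose s i := invmx (g i) *m h i *m g i.
have sH i : s i \in H.
  have [giH _ _] := gP i; have [hi _] := hH i; have [_ gVi] := HV _ giH.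
  exact: (HM _ _ (HM _ _ gVi hi) giH).
have beta0 i : beta i != 0.
  have [giH _ _] := gP i; apply: contraNneq (w0 i _ giH); rewrite -/(beta i) => ->.
  by rewrite mul0mx mxE.
have sE i x : x *m (s i)%:rat = x - (2 * q x (beta i) / q (beta i) (beta i)) *: beta i.
  have [giH _ _] := gP i; have [gu gVi] := HV _ giH.
  have gK : x *m (invmx (g i))%:rat *m (g i)%:rat = x.
    by rewrite -mulmxA -map_mxM mulVmx // map_mx1 mulmx1.
  rewrite !map_mxM !mulmxA bE mulmxBl gK -scalemxAl -/(beta i); congr (_ - (2 * _ / _) *: _).
    by rewrite -[LHS](invform_act _ _ giH) gK.
  by rewrite /beta invform_act.
(* The reflection of beta i in beta j is again a root of the class i; it or its
   opposite is positive, hence not lower than beta i. *)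
have lmin i j : 0 < q (beta i) (beta j) -> i != j ->
    l (beta i) * q (beta j) (beta j) <= q (beta i) (beta j) * l (beta j).
  move=> c0 ij; have [giH li gmin] := gP i; have [gjH lj _] := gP j.
  rewrite -/(beta i) in li; rewrite -/(beta j) in lj.
  have qj := invform_gt0 (beta0 j).
  have qi := invform_gt0 (beta0 i).
  have lr : l (beta i *m (s j)%:rat) = l (beta i) - 2 * q (beta i) (beta j) / q (beta j) (beta j) * l (beta j).
    by rewrite sE -scaleNr lD lZ mulNr.
  set r := 2 * _ / _ in lr.
  have rE : r * q (beta j) (beta j) = 2 * q (beta i) (beta j) by rewrite mulfVK ?gt_eqF.
  have r0 : 0 < r by rewrite /r divr_gt0 // mulr_gt0.
  suff : 2 * l (beta i) <= r * l (beta j) by nra.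
  have [lr0|lr0] := ltP 0 (l (beta i *m (s j)%:rat)).
    have := gmin (g i *m s j) (HM _ _ giH (sH j)).
    by rewrite map_mxM mulmxA => /(_ lr0); rewrite -/(beta i) lr; nra.
  have [hi ri] := hH i.
  have bh : b i *m (h i)%:rat = - b i.
    rewrite bE mulfK ?gt_eqF ?invform_gt0 //.
    by rewrite -[X in X - _]scale1r -scalerBl (_ : 1 - 2 = -1) // scaleN1r.
  have := gmin (h i *m (g i *m s j)) (HM _ _ hi (HM _ _ giH (sH j))).
  rewrite map_mxM mulmxA bh mulNmx map_mxM mulmxA -/(beta i).
  have lN x : l (- x) = - l x by rewrite -scaleN1r lZ mulN1r.
  have nz : l (beta i *m (s j)%:rat) != 0.
    by rewrite /beta -mulmxA -map_mxM; apply: w0; exact: HM.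
  rewrite lN oppr_gt0 lt_neqAle nz lr0 => /(_ isT); rewrite lr; lra.
apply: (@obtuse_independent k beta w) => [i|i j ij]; first by have [] := gP i.
rewrite leNgt; apply/negP => c0.
have qj := invform_gt0 (beta0 j); have qi := invform_gt0 (beta0 i).
have [_ li _] := gP i; have [_ lj _] := gP j.
rewrite -/(beta i) in li; rewrite -/(beta j) in lj.
have e1 := lmin _ _ c0 ij; have e2 : l (beta j) * q (beta i) (beta i) <= q (beta i) (beta j) * l (beta i).
  by rewrite invformC lmin // 1?eq_sym // invformC.
have col : q (beta j) (beta j) *: beta i = q (beta i) (beta j) *: beta j.
  apply: invform_colinear => //.
  set A := q (beta i) (beta i) in e1 e2 qi *; set B := q (beta j) (beta j) in e1 e2 qj *.
  set c := q _ _ in e1 e2 c0 *; set u := l (beta i) in e1 e2 li; set v := l (beta j) in e1 e2 lj.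
  have : (u * B) * (v * A) <= (c * v) * (c * u).
    by rewrite ler_pM // mulr_ge0 // ltW.
  by rewrite -(ler_pM2l (mulr_gt0 li lj)); nra.
have sij : s i = s j.
  apply: ratmx_inj; apply/row_matrixP => a; rewrite ![row a _]rowE !sE; congr (_ - _).
  set x := delta_mx _ _.
  have [t t0 bt] : exists2 t, t != 0 & beta i = t *: beta j.
    exists (q (beta i) (beta j) / q (beta j) (beta j)); first by rewrite mulf_neq0 ?invr_eq0 ?gt_eqF.
    by rewrite mulrC -scalerA -col scalerA mulVf ?gt_eqF // scale1r.
  rewrite bt !(invformZl, invformZr) scalerA; congr (_ *: _).
  by field; rewrite t0 gt_eqF.
have class_s a : conj_class H (s a) = conj_class H (h a).
  have [gaH _ _] := gP a; have [gu gV] := HV _ gaH.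
  apply/seteqP; split=> _ [t tH <-].
    have [tu tV] := HV _ tH; exists (g a *m t); first exact: HM.
    by rewrite invmx_mul // /s !mulmxA.
  have [tu tV] := HV _ tH; exists (invmx (g a) *m t); first exact: HM.
  rewrite invmx_mul ?unitmx_inv // invmxK /s !mulmxA.
  by rewrite (mulmxK gu) (mulmxK gu).
by apply: (h_inj i j ij); rewrite -!class_s sij.
Qed.

End InvariantForm.

(** * The invariants a and b *)

Lemma ncard_eq (T : Type) (A : set T) k : (A #= `I_k)%card -> ncard A = k.
Proof.
move=> Ak; rewrite /ncard; case: xgetP => [m _ Am|/(_ k)//].
by apply/card_eq_II; rewrite -(card_eql Am).
Qed.

Lemma ncard_infinite (T : Type) (A : set T) : infinite_set A -> ncard A = 0%N.
Proof.
move=> Ainf; rewrite /ncard; case: xgetP => [m _ Am|//].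
by exfalso; apply: Ainf; apply/finite_setP; exists m.
Qed.

Lemma ncard_fset (T : choiceType) (A : set T) : finite_set A -> ncard A = #|` fset_set A|.
Proof. by move=> /finite_setP[k Ak]; rewrite (ncard_eq Ak) (card_fset_set Ak). Qed.

Section Invariants.
Variables (n : nat) (H : {fset 'M[int]_n}).

Lemma rk_gt0 (h : 'M[int]_n) : h != 1%:M -> (0 < rk h)%N.
Proof.
move=> h1; rewrite /rk lt0n mxrank_eq0; apply: contraNneq h1 => h0.
by rewrite -subr_eq0; apply/eqP/ratmx_inj; rewrite /= h0 map_mx0.
Qed.

Lemma a_inv_le h : h \in H -> h != 1%:M -> (a_inv H <= rk h)%N.
Proof.
rewrite /a_inv -[h \in H]/(h \in enum_fset H).
elim: (enum_fset H) => //= g s IHs; rewrite inE big_cons.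
move=> /predU1P[->|hs] h1; first by rewrite h1 geq_minl.
by case: ifP => _; rewrite ?geq_min IHs ?orbT.
Qed.

Lemma a_inv_gt0 : (0 < n)%N -> (0 < a_inv H)%N.
Proof.
move=> n0; rewrite /a_inv; apply: (big_ind (fun m => 0 < m)%N) => //.
  by move=> a b a0 b0; rewrite leq_min a0.
by move=> h; exact: rk_gt0.
Qed.

(** Distinct orbits come from distinct conjugacy classes, and these are classes
    of reflections. *)
Lemma b_inv_le : finite_subgroup H -> a_inv H = 1%N -> (b_inv H <= n)%N.
Proof.
move=> HG a1; rewrite /b_inv a1.
set A := [set class_orbit H (conj_class H h) | h in _].
have [Afin|/ncard_infinite -> //] := pselect (finite_set A).
rewrite ncard_fset //; set X := fset_set A.
have XA i : (i < #|` X|)%N -> A (nth set0 X i).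
  by move=> iX; apply/set_mem; rewrite -in_fset_set // mem_nth.
have /fin_all_exists[h hP] (i : 'I_#|` X|) : exists h, (h \in H /\ rk h = 1%N) /\
    class_orbit H (conj_class H h) = nth set0 X i.
  by have [h hH hi] := XA i (ltn_ord i); exists h.
apply: (reflection_classes_le HG (h := h)) => [i|i j ij hij]; first by have [] := hP i.
have [_ ei] := hP i; have [_ ej] := hP j; move/eqP: ij; apply; apply/val_inj/eqP.
rewrite -(nth_uniq set0 (ltn_ord i) (ltn_ord j) (fset_uniq X)); apply/eqP.
exact: etrans (esym ei) (etrans (congr1 (class_orbit H) hij) ej).
Qed.

End Invariants.

Section SignGroup.
Variable n : nat.

Definition sign_mx (e : {ffun 'I_n -> bool}) : 'M[int]_n := diag_mx (\row_i (-1) ^+ e i).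

Definition sign_group : {fset 'M[int]_n} := [fset sign_mx e | e in {: {ffun 'I_n -> bool}}]%fset.

Lemma sign_mxM e f : sign_mx e *m sign_mx f = sign_mx [ffun i => e i (+) f i].
Proof.
rewrite /sign_mx mulmx_diag; congr diag_mx; apply/rowP => i.
by rewrite !mxE ffunE signr_addb.
Qed.

Lemma sign_mx0 : sign_mx [ffun=> false] = 1%:M.
Proof. by rewrite -diag_const_mx; congr diag_mx; apply/rowP => i; rewrite !mxE ffunE. Qed.

Lemma sign_mxK e : sign_mx e *m sign_mx e = 1%:M.
Proof. by rewrite sign_mxM -sign_mx0; congr sign_mx; apply/ffunP => i; rewrite !ffunE addbb. Qed.

Lemma sign_mx_inj : injective sign_mx.
Proof.
move=> e f /matrixP ef; apply/ffunP => i; have := ef i i.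
by rewrite !mxE eqxx !mulr1n; case: (e i); case: (f i).
Qed.

Lemma sign_groupP h : reflect (exists e, h = sign_mx e) (h \in sign_group).
Proof.
rewrite /sign_group; apply: (iffP (imfsetP _ _ _ _)) => [[e _ ->]|[e ->]]; first by exists e.
by exists e.
Qed.

Lemma sign_group_finite_subgroup : finite_subgroup sign_group.
Proof.
split=> [|_ /sign_groupP[e ->]|_ _ /sign_groupP[e ->] /sign_groupP[f ->]].
- by apply/sign_groupP; exists [ffun=> false]; rewrite sign_mx0.
- have [u _] := mulmx1_unit (sign_mxK e); split=> //.
  have -> : invmx (sign_mx e) = sign_mx e by rewrite -[RHS](mulKmx u) sign_mxK mulmx1.
  by apply/sign_groupP; exists e.
- by apply/sign_groupP; eexists; exact: sign_mxM.
Qed.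

Definition reflection_mx (k : 'I_n) := sign_mx [ffun i => i == k].

Lemma reflection_mx_inj : injective reflection_mx.
Proof.
move=> i j /sign_mx_inj/ffunP/(_ i); rewrite !ffunE eqxx => /esym/eqP //.
Qed.

Lemma reflection_mx_neq1 k : reflection_mx k != 1%:M.
Proof.
rewrite -sign_mx0; apply/eqP => /sign_mx_inj/ffunP/(_ k).
by rewrite !ffunE eqxx.
Qed.

Lemma rk_reflection_mx k : rk (reflection_mx k) = 1%N.
Proof.
rewrite /rk (_ : _%:rat = (-2) *: delta_mx k k).
  by rewrite mxrank_scale_nz // mxrank_delta.
apply/matrixP => i j; rewrite !mxE !ffunE.
have [<-|ij] := eqVneq i j.
  by have [ik|ik] := eqVneq i k; rewrite /= ?mulr1 ?mulr0.
by have [ik|ik] := eqVneq i k; rewrite /= ?mulr0 // -ik eq_sym (negbTE ij) mulr0.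
Qed.

(** If the entries at i and j were both -1, then the rows i and j of the
    difference with the identity would not be proportional. *)
Lemma rank1_sign_mx e : rk (sign_mx e) = 1%N -> exists k, sign_mx e = reflection_mx k.
Proof.
rewrite /rk; set A := map_mx _ _ => rA.
have AE i j : A i j = if (i == j) && e i then -2 else 0.
  by rewrite !mxE; case: eqVneq => //= _; case: (e i).
have [i ei] : exists i, e i.
  apply: contrapT => noe; suff A0 : A = 0 by rewrite A0 mxrank0 in rA.
  apply/matrixP => i j; rewrite AE mxE; case: ifP => // /andP[_ ei].
  by exfalso; apply: noe; exists i.
have rowi : row i A != 0.
  by apply: contraTneq isT => /rowP/(_ i); rewrite [LHS]mxE AE eqxx ei [RHS]mxE.
have Ai : (A <= row i A)%MS.
  by rewrite -(mxrank_leqif_sup (row_sub i A)) rA rank_rV rowi.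
exists i; congr sign_mx; apply/ffunP => j; rewrite ffunE.
have [->//|ji] := eqVneq j i; apply/negbTE/negP => ej.
have /sub_rVP[c /rowP/(_ j)] := submx_trans (row_sub j A) Ai.
by rewrite [LHS]mxE AE eqxx ej [RHS]mxE [X in _ = _ * X]mxE AE eq_sym (negbTE ji) mulr0.
Qed.

Lemma sign_group_a_inv : (0 < n)%N -> a_inv sign_group = 1%N.
Proof.
move=> n0; apply/eqP; rewrite eqn_leq a_inv_gt0 // andbT -(rk_reflection_mx (Ordinal n0)).
by apply: a_inv_le (reflection_mx_neq1 _); apply/sign_groupP; eexists.
Qed.

Lemma sign_group_neq1 : (0 < n)%N -> sign_group != [fset 1%:M]%fset.
Proof.
move=> n0; apply: contraNneq (reflection_mx_neq1 (Ordinal n0)) => e1.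
by rewrite -in_fset1 -e1; apply/sign_groupP; eexists.
Qed.

(** Classes of an abelian group are singletons, and a power of a reflection is the
    reflection itself or 1, so the n coordinate reflections have distinct orbits. *)
Lemma sign_group_b_inv : (0 < n)%N -> b_inv sign_group = n.
Proof.
move=> n0; rewrite /b_inv sign_group_a_inv //; apply: ncard_eq.
pose orb k := class_orbit sign_group (conj_class sign_group (reflection_mx k)).
have conjE k : conj_class sign_group (reflection_mx k) = [set reflection_mx k].
  have comm e : sign_mx e *m reflection_mx k = reflection_mx k *m sign_mx e.
    by rewrite !sign_mxM; congr sign_mx; apply/ffunP => i; rewrite !ffunE addbC.
  have fixed g : g \in sign_group -> invmx g *m reflection_mx k *m g = reflection_mx k.
    move=> /sign_groupP[e ->]; have [u _] := mulmx1_unit (sign_mxK e).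
    by rewrite -mulmxA -comm mulKmx.
  apply/seteqP; split=> [_ [g gH <-]|_ ->] /=; first exact: fixed.
  have [H1 _ _] := sign_group_finite_subgroup.
  by exists 1%:M => //; exact: fixed.
have orb_inj : injective orb.
  move=> i j ij; apply: reflection_mx_inj.
  have : orb i (cyclo_act sign_group idfun [set reflection_mx i]).
    by exists (idfun : {rmorphism algC -> algC}); rewrite conjE.
  rewrite ij => -[s]; rewrite conjE => /seteqP[+ _].
  move=> /(_ (reflection_mx i)) [|_ [k [-> _]]].
    by exists (reflection_mx i), 1%N; split=> // z _; rewrite expr1.
  have pw m : reflection_mx j ^+ m = if odd m then reflection_mx j else 1%:M.
    elim: m => [|m IHm]; first by rewrite expr0.
    by rewrite exprS IHm /=; case: (odd m) => /=; [exact: sign_mxK|exact: mulmx1].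
  rewrite pw; case: ifP => // _ e1; move: (reflection_mx_neq1 i).
  by rewrite e1 eqxx.
have -> : [set class_orbit sign_group (conj_class sign_group h) | h in
    [set h | h \in sign_group /\ rk h = 1%N]] = orb @` [set: 'I_n].
  apply/seteqP; split=> [_ [_ [/sign_groupP[e ->] r1] <-]|_ [k _ <-]].
    by have [k ->] := rank1_sign_mx r1; exists k.
  exists (reflection_mx k) => //; split; last exact: rk_reflection_mx.
  by apply/sign_groupP; eexists.
apply: card_eq_trans (_ : [set: 'I_n] #= `I_n)%card; last by rewrite card_eq_sym card_II.
by apply: inj_card_eq => i j _ _; exact: orb_inj.
Qed.

End SignGroup.

(** * Galois conjugates of algebraic numbers *)

(** The isomorphism from Q(x) to Q(y) extends to the splitting field of the
    minimal polynomial, and from there to an automorphism of Qbar. *)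
Lemma conjugate_exists (x y : algC) : root (minCpoly x) y -> exists s : GQ, s x = y.
Proof.
move=> px_y; have [p [px p_monic] p_min] := minCpolyP x.
have [r pr] := closed_field_poly_normal (minCpoly x).
rewrite (monicP (minCpoly_monic x)) scale1r in pr.
have rE z : (z \in r) = root (minCpoly x) z by rewrite pr root_prod_XsubC.
have [L [toC [rr rrE genL]]] := num_field_exists r.
have [x1 x1rr x1E] : exists2 x1, x1 \in rr & toC x1 = x.
  by have := root_minCpoly x; rewrite -rE -rrE => /mapP[x1 ? ->]; exists x1.
have [y1 y1rr y1E] : exists2 y1, y1 \in rr & toC y1 = y.
  by move: px_y; rewrite -rE -rrE => /mapP[y1 ? ->]; exists y1.
have toC_alg (q : {poly rat}) : map_poly toC (map_poly (in_alg L) q) = pQtoC q.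
  rewrite -map_poly_comp; apply: eq_map_poly => a.
  by rewrite /= rmorphZ_num rmorph1 mulr1.
have y1_root : root (map_poly \1%VF (minPoly 1 x1)) y1.
  have -> : map_poly \1%VF (minPoly 1 x1) = minPoly 1 x1.
    by rewrite map_polyE map_id_in ?polyseqK // => z _; rewrite id_lfunE.
  have [q qE] : exists q, minPoly 1 x1 = map_poly (in_alg L) q.
    have /fin_all_exists[a aE] (i : 'I_(size (minPoly 1 x1))) :
        exists a, (minPoly 1 x1)`_i = a%:A.
      by apply/vlineP; apply/polyOverP; exact: minPolyOver.
    exists (\poly_(i < size (minPoly 1 x1)) oapp a 0 (insub i)).
    apply/polyP => i; rewrite coef_map coef_poly.
    case: ifP => [il|/negbT]; last first.
      rewrite -leqNgt => /(nth_default 0) ->.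
      by rewrite raddf0.
    by rewrite insubT /= -aE.
  rewrite -(fmorph_root toC) qE toC_alg y1E.
  have : root (pQtoC q) x by rewrite -toC_alg -qE -x1E fmorph_root root_minPoly.
  by rewrite p_min => /dvdpP[u ->]; rewrite rmorphM rootM /= -px px_y orbT.
have hom1 : kHom 1 1 (\1%VF : 'End(L)) by rewrite kHom1.
have homE := kHomExtendP (sub1v _) hom1 y1_root.
have splitL : splittingFieldFor <<1; x1>>%VS (map_poly (in_alg L) p) fullv.
  apply: splittingFieldForS (sub1v _) (subvf _) _; exists rr => //.
  congr (_ %= _): (eqpxx (map_poly (in_alg L) p)); apply/(map_poly_inj toC).
  rewrite toC_alg -px pr -rrE big_map rmorph_prod /=; apply: eq_bigr => z _.
  by rewrite map_polyXsubC.
have pQ : map_poly (in_alg L) p \is a polyOver 1%VS.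
  by apply/polyOverP => i; rewrite coef_map memvZ ?memv_line.
have [f f_hom fE] := kHom_extends (sub1v _) homE pQ splitL.
have f_mono : monoid_morphism f by apply/kHom_monoid_morphism.
pose fM := GRing.isMonoidMorphism.Build _ _ f f_mono.
pose fR : {rmorphism _ -> _} := HB.pack (fun_of_lfun f) fM.
have [s sE] := extend_algC_subfield_aut toC fR.
exists s; rewrite -x1E -sE -y1E; congr (toC _).
rewrite /= -fE ?memv_adjoin //; exact: (kHomExtend_val hom1 y1_root).
Qed.

(** If no automorphism moves x, then its minimal polynomial is a power of
    X - x, and its subleading coefficient makes x rational. *)
Lemma fixed_Crat (x : algC) : (forall s : GQ, s x = x) -> x \in Crat.
Proof.
move=> fix_x; have [p [px _] _] := minCpolyP x.
have [r pr] := closed_field_poly_normal (minCpoly x).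
rewrite (monicP (minCpoly_monic x)) scale1r in pr.
have rx z : z \in r -> z = x.
  by rewrite -root_prod_XsubC -pr => /conjugate_exists[s <-]; rewrite fix_x.
have r0 : size r != 0%N.
  by rewrite size_eq0; apply: contraTneq (size_minCpoly x) => r0; rewrite pr r0 big_nil size_poly1.
have := coefPn_prod_XsubC r0; rewrite -pr px coef_map /=.
rewrite (eq_big_seq (fun=> x)) => [|z /rx -> //].
rewrite big_const_seq count_predT iter_addr_0 => /(congr1 -%R); rewrite opprK => xE.
have -> : x = (x *+ size r) / (size r)%:R by rewrite -[x *+ _]mulr_natr mulfK ?pnatr_eq0.
by rewrite -xE rpred_div ?rpred_nat // rpredN Crat_rat.
Qed.

(** Conjugates are roots of the minimal polynomial. *)
Lemma galois_orbit_finite (I : finType) (c : I -> algC) :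
  finite_set (range (fun s : GQ => [ffun i => s (c i)])).
Proof.
have /fin_all_exists[r rE] i : exists r : seq algC, forall s : GQ, s (c i) \in r.
  have [r pr] := closed_field_poly_normal (minCpoly (c i)); exists r => s.
  rewrite -root_prod_XsubC; have := root_minCpoly (s (c i)); rewrite minCpoly_aut pr.
  by rewrite (monicP (minCpoly_monic _)) scale1r.
pose R := flatten [seq r i | i <- enum I].
pose F (f : {ffun I -> 'I_(size R).+1}) := [ffun i => R`_(f i)].
apply: (@sub_finite_set _ _ (F @` setT)); last exact: finite_image.
move=> _ [s _ <-]; exists [ffun i => inord (index (s (c i)) R)] => //.
have sR i : s (c i) \in R.
  by apply/flatten_mapP; exists i; rewrite ?mem_enum ?rE.
by apply/ffunP => i; rewrite !ffunE inordK ?nth_index // ltnS index_size.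
Qed.

(** Summing a vector over its finite Galois orbit gives a Galois-invariant,
    hence rational, vector: this plays the role of a trace. *)
Lemma galois_orbit_sum (I : finType) (c : I -> algC) :
  exists V : seq {ffun I -> algC}, [/\ (0 < size V)%N,
    forall v, v \in V -> exists s : GQ, v = [ffun i => s (c i)]
    & forall i, \sum_(v <- V) v i \in Crat].
Proof.
have Ofin := galois_orbit_finite c.
pose V := enum_fset (fset_set (range (fun s : GQ => [ffun i => s (c i)]))).
have VP v : reflect (exists s : GQ, v = [ffun i => s (c i)]) (v \in V).
  apply: (iffP idP) => [|[s ->]].
    by rewrite [v \in V]in_fset_set // => /set_mem[s _ <-]; exists s.
  by rewrite [_ \in V]in_fset_set //; apply/mem_set; exists s.
exists V; split=> [|v /VP//|i].
  have : [ffun i => (idfun : GQ) (c i)] \in V by apply/VP; exists (idfun : GQ).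
  by case: V {VP}.
apply: fixed_Crat => s; rewrite rmorph_sum /=.
pose act (v : {ffun I -> algC}) := [ffun i => s (v i)].
have actV : perm_eq (map act V) V.
  have Vu : uniq V by exact: fset_uniq.
  have act_inj : injective act.
    by move=> v w /ffunP vw; apply/ffunP => j; have := vw j; rewrite !ffunE => /fmorph_inj.
  have sub : {subset map act V <= V}.
    move=> _ /mapP[v /VP[t ->] ->]; apply/VP; exists (s \o t : GQ).
    by apply/ffunP => j; rewrite !ffunE.
  have mapu : uniq (map act V) by rewrite map_inj_uniq.
  have [|_ mE] := uniq_min_size mapu sub; first by rewrite size_map.
  exact: uniq_perm.
rewrite -[RHS](perm_big _ actV) big_map; apply: eq_bigr => v _.
by rewrite ffunE.
Qed.

(** * Regular functions, and isomorphisms over a field *)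

Lemma map_mx_autK (s : GQ) N (x : 'M[algC]_N) : map_mx s (map_mx (algC_invaut s) x) = x.
Proof. by apply/matrixP => i j; rewrite !mxE algC_invautK. Qed.

Lemma map_mx_autVK (s : GQ) N (x : 'M[algC]_N) : map_mx (algC_invaut s) (map_mx s x) = x.
Proof. by apply/matrixP => i j; rewrite !mxE algC_autK. Qed.

(** Separates the coefficients of a regular function, on which Galois acts, from
    functions over Q, which commute with Galois. *)
Lemma regfun_decomp N (f : 'M[algC]_N -> algC) : regfun predT f ->
  exists (I : finType) (c : I -> algC) (g : I -> 'M[algC]_N -> algC),
    (forall i, regfun Crat (g i)) /\ forall x, f x = \sum_i c i * g i x.
Proof.
elim=> [c _|i j||f1 f2 _ [I1 [c1 [g1 [r1 E1]]]] _ [I2 [c2 [g2 [r2 E2]]]]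
                 |f1 f2 _ [I1 [c1 [g1 [r1 E1]]]] _ [I2 [c2 [g2 [r2 E2]]]]].
- exists unit, (fun=> c), (fun _ _ => 1); split=> [_|x]; first exact: regfun_cst (rpred1 _).
  by rewrite big_const cardT enumT unlock /= addr0 mulr1.
- exists unit, (fun=> 1), (fun _ x => x i j); split=> [_|x]; first exact: regfun_entry.
  by rewrite big_const cardT enumT unlock /= addr0 mul1r.
- exists unit, (fun=> 1), (fun _ x => (\det x)^-1); split=> [_|x]; first exact: regfun_invdet.
  by rewrite big_const cardT enumT unlock /= addr0 mul1r.
- exists (I1 + I2)%type, (fun i => match i with inl a => c1 a | inr a => c2 a end),
    (fun i => match i with inl a => g1 a | inr a => g2 a end).
  by split=> [[a|a] //|x]; rewrite big_sumType /= E1 E2.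
- exists (I1 * I2)%type, (fun i => c1 i.1 * c2 i.2), (fun i x => g1 i.1 x * g2 i.2 x).
  split=> [[a b]|x]; first exact: regfun_mul.
  rewrite E1 E2 big_distrlr pair_big /=; apply: eq_bigr => i _.
  by rewrite mulrACA.
Qed.

(** A regular function over Qbar commuting with Galois is unchanged when its
    coefficients are conjugated, so they may be replaced by their averages. *)
Lemma regfun_galois_descent N (D : set 'M[algC]_N) f : regfun predT f ->
  (forall (s : GQ) x, D x -> D (map_mx s x)) ->
  (forall (s : GQ) x, D x -> f (map_mx s x) = s (f x)) ->
  exists2 g, regfun Crat g & forall x, D x -> f x = g x.
Proof.
move=> /regfun_decomp[I [c [g [gQ fE]]]] Dgal fgal.
have [V [V0 Vorb VQ]] := galois_orbit_sum c.
have fV v x : v \in V -> D x -> f x = \sum_i v i * g i x.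
  move=> /Vorb[s ->] Dx; have Dx' := Dgal (algC_invaut s) x Dx.
  have sx := map_mx_autK s x.
  rewrite -[in LHS]sx fgal // fE rmorph_sum; apply: eq_bigr => i _.
  by rewrite rmorphM ffunE -(regfun_Crat _ (gQ i)) sx.
exists (fun x => \sum_i ((\sum_(v <- V) v i) / (size V)%:R) * g i x).
  apply: regfun_sum => [|i]; first exact: rpred0.
  by apply: regfun_mul => //; apply: regfun_cst; rewrite rpred_div ?rpred_nat.
move=> x Dx; apply: (mulfI (_ : (size V)%:R != 0)); first by rewrite pnatr_eq0 -lt0n.
rewrite mulr_sumr mulr_natl.
transitivity (\sum_(v <- V) \sum_i v i * g i x).
  rewrite (eq_big_seq (fun=> f x)) => [|v vV]; last by rewrite -fV.
  by rewrite big_const_seq count_predT iter_addr_0.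
rewrite exchange_big; apply: eq_bigr => i _ /=; rewrite -mulr_suml mulrA; congr (_ * _).
by rewrite mulrC mulfVK // pnatr_eq0 -lt0n.
Qed.

Section RegularComposition.
Variable k : {pred algC}.
Hypotheses (k0 : 0 \in k) (k1 : 1 \in k) (kN1 : -1 \in k).

Lemma regfun_sign N (b : bool) : regfun k (fun _ : 'M[algC]_N => (-1) ^+ b).
Proof. by apply: regfun_cst; case: b. Qed.

Lemma regfun_determinant N m (F : 'I_m -> 'I_m -> 'M[algC]_N -> algC) :
  (forall i j, regfun k (F i j)) -> regfun k (fun x => \det (\matrix_(i, j) F i j x)).
Proof.
move=> rF; apply: regfun_sum => // s; apply: regfun_mul; first exact: regfun_sign.
apply: regfun_prod => // i.
by under eq_fun do rewrite mxE; exact: rF.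
Qed.

Lemma regfun_comp_invmx N (f : 'M[algC]_N -> algC) : regfun k f ->
  exists2 g, regfun k g & forall x, x \in unitmx -> f (invmx x) = g x.
Proof.
elim=> [c ck|i j||f1 f2 _ [g1 r1 E1] _ [g2 r2 E2]|f1 f2 _ [g1 r1 E1] _ [g2 r2 E2]].
- by exists (fun=> c) => //; exact: regfun_cst.
- exists (fun x => (\det x)^-1 * ((-1) ^+ odd (j + i) *
      \det (\matrix_(a, b) (fun y : 'M[algC]_N => y (lift j a) (lift i b)) x))).
    apply: regfun_mul; first exact: regfun_invdet.
    apply: regfun_mul; first exact: regfun_sign.
    by apply: regfun_determinant => a b; exact: regfun_entry.
  move=> x ux; rewrite /invmx ux !mxE /cofactor signr_odd; congr (_ * (_ * \det _)).
  by apply/matrixP => a b; rewrite !mxE.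
- exists (fun x => \det (\matrix_(a, b) (fun y : 'M[algC]_N => y a b) x)).
    by apply: regfun_determinant => a b; exact: regfun_entry.
  move=> x ux; rewrite det_inv invrK; congr (\det _).
  by apply/matrixP => a b; rewrite mxE.
- exists (fun x => g1 x + g2 x); first exact: regfun_add.
  by move=> x ux; rewrite E1 ?E2.
- exists (fun x => g1 x * g2 x); first exact: regfun_mul.
  by move=> x ux; rewrite E1 ?E2.
Qed.

End RegularComposition.

(** The domains of the maps to be composed: tori on one side, G_m^n on the other. *)
Record matrix_group N (G : set 'M[algC]_N) : Prop := MatrixGroup {
  mxgrp_unit : forall x, G x -> x \in unitmx;
  mxgrp1 : G 1%:M;
  mxgrpM : forall x y, G x -> G y -> G (x *m y);
  mxgrpV : forall x, G x -> G (invmx x) }.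

Lemma pts_matrix_group T : matrix_group (pts T).
Proof. by split; [exact: pts_unit|exact: pts_1|exact: pts_mul|exact: pts_inv]. Qed.

Lemma Gm_powP n (x : 'M[algC]_n) :
  Gm_pow x <-> exists2 d : 'rV_n, x = diag_mx d & forall i, d 0 i != 0.
Proof.
split=> [[ux /diag_mxP[d xd]]|[d -> d0]]; last first.
  split; last exact: diag_mx_is_diag.
  by rewrite unitmxE det_diag unitfE; apply/prodf_neq0 => i _.
exists d => // i; move: ux; rewrite xd unitmxE det_diag unitfE => /prodf_neq0 ->.
  by [].
by [].
Qed.

Lemma Gm_pow_matrix_group n : matrix_group (@Gm_pow n).
Proof.
split=> [x []//||x y /Gm_powP[d -> d0] /Gm_powP[e -> e0]|x /Gm_powP[d -> d0]].
- by apply/Gm_powP; exists (const_mx 1) => [|i]; rewrite ?diag_const_mx // mxE oner_neq0.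
- by rewrite mulmx_diag; apply/Gm_powP; eexists => // i; rewrite mxE mulf_neq0.
- pose e : 'rV[algC]_n := \row_i (d 0 i)^-1.
  have de : diag_mx d *m diag_mx e = 1%:M.
    rewrite mulmx_diag -diag_const_mx; congr diag_mx; apply/rowP => i.
    by rewrite !mxE mulfV.
  have [u _] := mulmx1_unit de.
  have -> : invmx (diag_mx d) = diag_mx e by rewrite -[RHS](mulKmx u) de mulmx1.
  by apply/Gm_powP; exists e => // i; rewrite mxE invr_eq0.
Qed.

Section MultiplicativeMaps.
Variables (N M : nat) (G : set 'M[algC]_N) (H : set 'M[algC]_M) (phi : 'M[algC]_N -> 'M[algC]_M).
Hypotheses (gG : matrix_group G) (gH : matrix_group H) (phiGH : forall x, G x -> H (phi x)).
Hypothesis phiM : forall x y, G x -> G y -> phi (x *m y) = phi x *m phi y.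

Lemma mult_map1 : phi 1%:M = 1%:M.
Proof.
have u := mxgrp_unit gH (phiGH (mxgrp1 gG)).
by rewrite -[LHS](mulKmx u) -phiM ?mulmx1 ?mulVmx //; exact: mxgrp1.
Qed.

Lemma mult_mapV x : G x -> phi (invmx x) = invmx (phi x).
Proof.
move=> Gx; have u := mxgrp_unit gH (phiGH Gx); have GVx := mxgrpV gG Gx.
by rewrite -[LHS](mulKmx u) -phiM // mulmxV ?mult_map1 ?mulmx1 //; exact: mxgrp_unit Gx.
Qed.

(** The inverse of the determinant is pulled back through inversion on the
    source, 1 / det (phi x) being det (phi (x^-1)). *)
Lemma regfun_comp (k : {pred algC}) (f : 'M[algC]_M -> algC) :
  0 \in k -> 1 \in k -> -1 \in k ->
  (forall i j, regfun k (fun x => phi x i j)) -> regfun k f ->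
  exists2 g, regfun k g & forall x, G x -> f (phi x) = g x.
Proof.
move=> k0 k1 kN1 rphi.
elim=> [c ck|i j||f1 f2 _ [g1 r1 E1] _ [g2 r2 E2]|f1 f2 _ [g1 r1 E1] _ [g2 r2 E2]].
- by exists (fun=> c) => //; exact: regfun_cst.
- by exists (fun x => phi x i j).
- have /fin_all_exists2[g rg gE] (ij : 'I_M * 'I_M) : exists2 g, regfun k g &
      forall x, x \in unitmx -> phi (invmx x) ij.1 ij.2 = g x.
    exact: (regfun_comp_invmx k0 k1 kN1 (rphi ij.1 ij.2)).
  exists (fun x => \det (\matrix_(i, j) g (i, j) x)).
    by apply: regfun_determinant => // i j; exact: rg.
  move=> x Gx; rewrite -det_inv -mult_mapV //; congr (\det _).
  by apply/matrixP => i j; rewrite mxE -gE //=; exact: mxgrp_unit Gx.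
- exists (fun x => g1 x + g2 x); first exact: regfun_add.
  by move=> x Gx; rewrite E1 ?E2.
- exists (fun x => g1 x * g2 x); first exact: regfun_mul.
  by move=> x Gx; rewrite E1 ?E2.
Qed.

Lemma regmap_comp (k : {pred algC}) P (psi : 'M[algC]_M -> 'M[algC]_P) :
  0 \in k -> 1 \in k -> -1 \in k ->
  (forall i j, regfun k (fun x => phi x i j)) ->
  (forall i j, regfun k (fun x => psi x i j)) ->
  exists2 th : 'M[algC]_N -> 'M[algC]_P, forall i j, regfun k (fun x => th x i j)
    & forall x, G x -> psi (phi x) = th x.
Proof.
move=> k0 k1 kN1 rphi rpsi.
have /fin_all_exists2[g rg gE] (ij : 'I_P * 'I_P) : exists2 g, regfun k g &
    forall x, G x -> psi (phi x) ij.1 ij.2 = g x.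
  exact: (regfun_comp k0 k1 kN1 rphi (rpsi ij.1 ij.2)).
exists (fun x => \matrix_(i, j) g (i, j) x) => [i j|x Gx].
  by under eq_fun do rewrite mxE; exact: rg.
by apply/matrixP => i j; rewrite mxE -gE.
Qed.

End MultiplicativeMaps.

Section Isomorphisms.
Variable k : {pred algC}.
Hypotheses (k0 : 0 \in k) (k1 : 1 \in k) (kN1 : -1 \in k).

Lemma isom_over_refl N (G : set 'M[algC]_N) : isom_over k G G.
Proof. by exists id, id; split=> // i j; exact: regfun_entry. Qed.

Lemma isom_over_sym N M (G : set 'M[algC]_N) (H : set 'M[algC]_M) :
  matrix_group G -> isom_over k G H -> isom_over k H G.
Proof.
move=> gG [phi [psi [rphi rpsi GH HG phiM]]]; exists psi, phi; split=> // y y' Hy Hy'.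
have [Gy yE] := HG _ Hy; have [Gy' yE'] := HG _ Hy'.
by rewrite -[in LHS]yE -[in LHS]yE' -phiM //; have [] := GH _ (mxgrpM gG Gy Gy').
Qed.

Lemma isom_over_trans N M P (G : set 'M[algC]_N) (H : set 'M[algC]_M) (K : set 'M[algC]_P) :
  matrix_group G -> matrix_group H -> matrix_group K ->
  isom_over k G H -> isom_over k H K -> isom_over k G K.
Proof.
move=> gG gH gK GH HK.
move: GH HK => [phi [psi [rphi rpsi GH HG phiM]]] [phi' [psi' [rphi' rpsi' HK KH phiM']]].
have psiM' y y' : K y -> K y' -> psi' (y *m y') = psi' y *m psi' y'.
  move=> Ky Ky'; have [Hy yE] := KH _ Ky; have [Hy' yE'] := KH _ Ky'.
  by rewrite -[in LHS]yE -[in LHS]yE' -phiM' //; have [] := HK _ (mxgrpM gH Hy Hy').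
have GH1 x : G x -> H (phi x) by move=> /GH[].
have KH1 x : K x -> H (psi' x) by move=> /KH[].
have [th rth thE] := regmap_comp gG gH GH1 phiM k0 k1 kN1 rphi rphi'.
have [th' rth' thE'] := regmap_comp gK gH KH1 psiM' k0 k1 kN1 rpsi' rpsi.
exists th, th'; split=> // [x Gx|y Ky|x x' Gx Gx'].
- have [Hx xE] := GH _ Gx; have [Kx xE'] := HK _ Hx.
  by rewrite -thE // -thE' // xE' xE.
- have [Hy yE] := KH _ Ky; have [Gy yE'] := HG _ Hy.
  by rewrite -thE' // -thE // yE' yE.
- by rewrite -!thE ?phiM ?phiM' //; [exact: GH1|exact: GH1|exact: (mxgrpM gG)].
Qed.

End Isomorphisms.

(** * Characters of G_m^n *)

Section Monomials.
Variable n : nat.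
Implicit Types (m : 'I_n -> int) (x y : 'M[algC]_n).

Definition monomial m x : algC := \prod_i x i i ^ m i.

Lemma Gm_pow_diag_neq0 x i : Gm_pow x -> x i i != 0.
Proof. by move=> /Gm_powP[d -> d0]; rewrite mxE eqxx mulr1n d0. Qed.

Lemma Gm_pow_mul_diag x y i : Gm_pow x -> (x *m y) i i = x i i * y i i.
Proof.
move=> /Gm_powP[d -> _]; by rewrite mul_diag_mx !mxE eqxx mulr1n.
Qed.

Lemma monomialM m x y : Gm_pow x -> monomial m (x *m y) = monomial m x * monomial m y.
Proof.
move=> Gx; rewrite -big_split; apply: eq_bigr => i _ /=.
by rewrite Gm_pow_mul_diag // expfzMl.
Qed.

Lemma monomialD m m' x : Gm_pow x -> monomial (fun i => m i + m' i) x = monomial m x * monomial m' x.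
Proof.
move=> Gx; rewrite -big_split; apply: eq_bigr => i _ /=.
by rewrite expfzDr // Gm_pow_diag_neq0.
Qed.

Lemma monomial_inj m m' : (forall x, Gm_pow x -> monomial m x = monomial m' x) -> m = m'.
Proof.
move=> mm'; apply/funext => i.
pose d : 'rV[algC]_n := \row_j if j == i then 2 else 1.
have Gd : Gm_pow (diag_mx d).
  by apply/Gm_powP; exists d => // j; rewrite mxE; case: ifP; rewrite ?pnatr_eq0 ?oner_neq0.
have dE u : monomial u (diag_mx d) = 2 ^ u i.
  rewrite /monomial (bigD1 i) //= !mxE eqxx big1 ?mulr1 // => j /negbTE ji.
  by rewrite !mxE eqxx ji exp1rz.
have := mm' _ Gd; rewrite !dE -[2](ratr_nat algC) -!rmorphXz ?unitfE //.
by move=> /fmorph_inj; exact: ieexprIz.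
Qed.

Definition laurent (f : 'M[algC]_n -> algC) := exists (I : finType) (c : I -> algC)
  (m : I -> 'I_n -> int), forall x, Gm_pow x -> f x = \sum_i c i * monomial (m i) x.

Lemma regfun_laurent f : regfun predT f -> laurent f.
Proof.
have single c m : laurent (fun x => c * monomial m x).
  exists unit, (fun=> c), (fun=> m) => x _.
  by rewrite big_const cardT enumT unlock /= addr0.
elim=> [c _|i j||f1 f2 _ [I1 [c1 [m1 E1]]] _ [I2 [c2 [m2 E2]]]
                |f1 f2 _ [I1 [c1 [m1 E1]]] _ [I2 [c2 [m2 E2]]]].
- have [I [a [m E]]] := single c (fun=> 0); exists I, a, m => x Gx; rewrite -E //.
  by rewrite /monomial big1 ?mulr1 // => i _; rewrite expr0z.
- have [I [a [m E]]] := single (i == j)%:R (fun l => (l == i)%:Z).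
  exists I, a, m => x Gx; rewrite -E // /monomial (bigD1 i) //= eqxx expr1z big1 => [|l /negbTE ->].
    rewrite mulr1; have /Gm_powP[d -> _] := Gx; rewrite !mxE eqxx.
    by have [->|ij] := eqVneq i j; rewrite ?mul1r ?mul0r.
  by rewrite expr0z.
- have [I [a [m E]]] := single 1 (fun=> -1); exists I, a, m => x Gx; rewrite -E // mul1r.
  have /Gm_powP[d -> _] := Gx; rewrite det_diag -prodfV; apply: eq_bigr => i _.
  by rewrite exprN1 mxE eqxx.
- exists (I1 + I2)%type, (fun i => match i with inl a => c1 a | inr a => c2 a end),
    (fun i => match i with inl a => m1 a | inr a => m2 a end) => x Gx.
  by rewrite big_sumType /= E1 // E2.
- exists (I1 * I2)%type, (fun i => c1 i.1 * c2 i.2), (fun i l => m1 i.1 l + m2 i.2 l) => x Gx.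
  rewrite E1 // E2 // big_distrlr pair_big /=; apply: eq_bigr => i _.
  by rewrite monomialD // mulrACA.
Qed.

(** Dedekind: a multiplicative function that is a linear combination of
    monomials is one of them. A monomial with which it disagrees at y can be
    eliminated by comparing the values at x and at y x. *)
Lemma multiplicative_laurent f : laurent f -> f 1%:M != 0 ->
  (forall x y, Gm_pow x -> Gm_pow y -> f (x *m y) = f x * f y) ->
  exists m, forall x, Gm_pow x -> f x = monomial m x.
Proof.
move=> [I [c [m fE]]] f1 fM.
suff dedekind (s : seq I) (b : I -> algC) :
    (forall x, Gm_pow x -> f x = \sum_(i <- s) b i * monomial (m i) x) ->
    exists m', forall x, Gm_pow x -> f x = monomial m' x by exact: dedekind fE.
elim: s b => [|i s IHs] b fb.
  by move: f1; rewrite fb ?big_nil ?eqxx //; exact: (mxgrp1 (Gm_pow_matrix_group n)).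
have [eqf|] := pselect (forall x, Gm_pow x -> f x = monomial (m i) x); first by exists (m i).
move=> /existsNP[y /not_implyP[Gy /eqP]]; rewrite -subr_eq0 => fy.
apply: (IHs (fun j => b j * (monomial (m j) y - monomial (m i) y) / (f y - monomial (m i) y))) => x Gx.
apply: (mulfI fy); rewrite mulr_sumr.
have Gyx := mxgrpM (Gm_pow_matrix_group n) Gy Gx.
have -> : (f y - monomial (m i) y) * f x = f (y *m x) - monomial (m i) y * f x.
  by rewrite fM // mulrBl.
rewrite (fb (y *m x)) // (fb x) // mulr_sumr -sumrB big_cons monomialM // mulrCA subrr add0r.
apply: eq_bigr => j _; rewrite monomialM //.
by field.
Qed.

End Monomials.

(** * The Galois action on the character lattice *)

Section CharacterLattice.
Variable T : Qgroup.
Implicit Types (c d : char T) (s t : GQ).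

Lemma char0E x : pts T x -> (0 : char T) x = 1.
Proof. by move=> Tx; rewrite /= asboolT. Qed.

Lemma char_mulrnE c k x : pts T x -> (c *+ k) x = c x ^+ k.
Proof.
move=> Tx; elim: k => [|k IHk]; first by rewrite mulr0n char0E.
by rewrite mulrS exprS -IHk.
Qed.

Lemma char_mulrzE c (z : int) x : pts T x -> (c *~ z) x = c x ^ z.
Proof.
move=> Tx; case: z => k; first by rewrite -pmulrn -exprnP char_mulrnE.
by rewrite NegzE mulrNz -pmulrn -exprnN -char_mulrnE.
Qed.

Lemma char_sumE (I : finType) (F : I -> char T) x : pts T x ->
  (\sum_i F i) x = \prod_i F i x.
Proof.
move=> Tx; apply: (big_morph (fun c : char T => c x)) => //.
exact: char0E.
Qed.

Lemma galactE s c x : galact s c x = s (c (map_mx (algC_invaut s) x)).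
Proof. by []. Qed.

Lemma galact_is_zmod_morphism s : zmod_morphism (galact s : char T -> char T).
Proof. by move=> c d; apply: char_ext => x Tx /=; rewrite rmorphM fmorphV. Qed.

HB.instance Definition _ s :=
  GRing.isZmodMorphism.Build (char T) (char T) (galact s) (galact_is_zmod_morphism s).

Lemma galact_comp s t c : galact (s \o t) c = galact s (galact t c).
Proof.
apply: char_ext => x Tx /=; congr (s (t (c _))); apply/matrixP => i j; rewrite !mxE.
apply: (fmorph_inj t); apply: (fmorph_inj s).
by rewrite !algC_invautK -[in RHS](algC_invautK (s \o t) (x i j)).
Qed.

Lemma galact_id c : galact idfun c = c.
Proof.
apply: char_ext => x Tx /=; congr (c _); apply/matrixP => i j; rewrite !mxE.
exact: (algC_invautK idfun).
Qed.

Definition lincomb n p (e : 'I_n -> char T) (A : 'M[int]_(n, p)) (j : 'I_p) : char T :=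
  \sum_i e i *~ A i j.

(** Matrices over int compose like the linear combinations they encode, so the
    identities below reduce to [lincomb_inj] and matrix algebra. *)
Lemma lincomb_mul n p q (e : 'I_n -> char T) (A : 'M[int]_(n, p)) (B : 'M[int]_(p, q)) :
  lincomb (lincomb e A) B = lincomb e (A *m B).
Proof.
apply/funext => j; rewrite /lincomb; under eq_bigr do rewrite mulrz_suml.
rewrite exchange_big; apply: eq_bigr => i _; rewrite mxE mulrz_sumr.
by apply: eq_bigr => k _; rewrite mulrzA.
Qed.

Lemma lincomb1 n (e : 'I_n -> char T) : lincomb e 1%:M = e.
Proof.
apply/funext => j; rewrite /lincomb (bigD1 j) //= mxE eqxx big1 ?addr0 // => i /negbTE ij.
by rewrite mxE ij mulr0z.
Qed.

Lemma galact_lincomb s n p (e : 'I_n -> char T) (A : 'M[int]_(n, p)) j :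
  galact s (lincomb e A j) = lincomb (fun i => galact s (e i)) A j.
Proof. by rewrite /lincomb raddf_sum; apply: eq_bigr => i _; rewrite raddfMz. Qed.

Section Basis.
Variables (n : nat) (e : 'I_n -> char T).
Hypothesis eB : char_basis e.

Lemma lincomb_inj p : injective (lincomb e : 'M[int]_(n, p) -> _).
Proof.
move=> A B AB; apply/matrixP => i j.
have [m [_ m_uniq]] := eB (lincomb e A j).
have mA := m_uniq (A^~ j) erefl; have mB := m_uniq (B^~ j) (congr1 (@^~ j) AB).
by rewrite -[A i j]/(A^~ j i) -mA mB.
Qed.

Lemma lincomb_surj p (f : 'I_p -> char T) : exists A, f = lincomb e A.
Proof.
have /fin_all_exists[m mE] j : exists m : 'I_n -> int, f j = \sum_i e i *~ m i.
  by have [m [mE _]] := eB (f j); exists m.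
exists (\matrix_(i, j) m j i); apply/funext => j; rewrite mE /lincomb.
by apply: eq_bigr => i _; rewrite mxE.
Qed.

Lemma galact_mxP s M : galact_mx e s M <-> (fun i => galact s (e i)) = lincomb e M.
Proof. by split=> [sM|sM j]; [apply/funext => j; exact: sM|rewrite -[LHS]/((fun i => galact s (e i)) j) sM]. Qed.

Lemma galact_mx_exists s : exists M, galact_mx e s M.
Proof. by have [M /galact_mxP sM] := lincomb_surj (fun i => galact s (e i)); exists M. Qed.

Lemma galact_mx_comp s t M N :
  galact_mx e s M -> galact_mx e t N -> galact_mx e (s \o t) (M *m N).
Proof.
move=> /galact_mxP sM /galact_mxP tN; apply/galact_mxP; rewrite -lincomb_mul -sM.
apply/funext => j; rewrite galact_comp -galact_lincomb.
by congr (galact s _); have := congr1 (@^~ j) tN.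
Qed.

Lemma gal_image1 : gal_image e 1%:M.
Proof. by exists idfun; apply/galact_mxP; rewrite lincomb1; apply/funext => i; exact: galact_id. Qed.

Lemma gal_imageM M N : gal_image e M -> gal_image e N -> gal_image e (M *m N).
Proof. by move=> [s sM] [t tN]; exists (s \o t); exact: galact_mx_comp. Qed.

Lemma gal_imageV M : gal_image e M -> M \in unitmx /\ gal_image e (invmx M).
Proof.
move=> [s sM]; have [N tN] := galact_mx_exists (algC_invaut s).
have NM : M *m N = 1%:M.
  apply: lincomb_inj; rewrite lincomb1; have /galact_mxP <- := galact_mx_comp sM tN.
  rewrite -[RHS](funext (fun i => galact_id (e i))); apply/funext => i.
  apply: char_ext => x Tx /=.
  have E (y : algC) : s (algC_invaut s y) = y by exact: algC_invautK.
  rewrite E; congr (e i _); apply/matrixP => a b; rewrite !mxE.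
  apply: (etrans _ (esym (algC_invautK idfun _))).
  by have := algC_invautK (s \o algC_invaut s) (x a b); rewrite /= E.
have [uM _] := mulmx1_unit NM; split=> //.
have -> : invmx M = N by rewrite -[RHS](mulKmx uM) NM mulmx1.
by exists (algC_invaut s).
Qed.

End Basis.

(** The action on a character only depends on the conjugates of the finitely
    many coefficients of a regular function representing it. *)
Lemma galact_orbit_finite c : exists (I : finType) (a : I -> algC),
  forall s t, (forall i, s (a i) = t (a i)) -> galact s c = galact t c.
Proof.
case: (cfunP c) => _ _ _ [f /regfun_decomp[I [a [g [gQ fE]]]] cf].
exists I, a => s t st; apply: char_ext => x Tx.
have actE u : galact u c x = \sum_i u (a i) * g i x.
  have ux := map_mx_autK u x.
  rewrite galactE cf -?pts_gal // fE rmorph_sum; apply: eq_bigr => i _.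
  by rewrite rmorphM -(regfun_Crat _ (gQ i)) ux.
by rewrite !actE; apply: eq_bigr => i _; rewrite st.
Qed.

(** Two automorphisms that agree on the coefficients of all the basis characters
    have the same matrix, and the tuples of conjugates form a finite set. *)
Lemma gal_image_finite n (e : 'I_n -> char T) : char_basis e -> finite_set (gal_image e).
Proof.
move=> eB.
have /fin_all_exists[I /fin_all_exists[a aE]] j := galact_orbit_finite (e j).
pose b (p : {j : 'I_n & I j}) := a (tag p) (tagged p).
pose S := range (fun s : GQ => [ffun p => s (b p)]).
have Sfin : finite_set S by exact: galois_orbit_finite.
pose F v := xget 1%:M [set M | exists2 s : GQ, v = [ffun p => s (b p)] & galact_mx e s M].
apply: (@sub_finite_set _ _ (F @` S)); last exact: finite_image.
move=> M [s sM]; exists [ffun p => s (b p)]; first by exists s.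
rewrite /F; case: xgetP => [N _ [t /ffunP st tN]|/(_ M)[]]; last by exists s.
apply: (lincomb_inj eB); move/galact_mxP: tN => <-; move/galact_mxP: sM => <-.
apply/funext => j; apply: aE => i.
by have := st (Tagged I i); rewrite !ffunE.
Qed.

Lemma gal_image_finite_subgroup n (e : 'I_n -> char T) : char_basis e ->
  exists2 H : {fset 'M[int]_n}, finite_subgroup H & gal_image e = [set` H].
Proof.
move=> eB; have Hfin := gal_image_finite eB.
have HE M : (M \in fset_set (gal_image e)) <-> gal_image e M.
  by rewrite in_fset_set //; split=> [/set_mem|/mem_set].
exists (fset_set (gal_image e)); last by apply/seteqP; split=> M /HE.
split=> [|M /HE /(gal_imageV eB)[uM /HE]|M N /HE HM /HE HN] //.
  exact/HE/gal_image1.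
exact/HE/gal_imageM.
Qed.

Lemma gal_image_basis_change n (e e' : 'I_n -> char T) :
  char_basis e -> char_basis e' -> conj_GLnZ (gal_image e) (gal_image e').
Proof.
move=> eB eB'; have [Q e'E] := lincomb_surj eB e'; have [R eE] := lincomb_surj eB' e.
have QR : Q *m R = 1%:M by apply: (lincomb_inj eB); rewrite lincomb1 -lincomb_mul -e'E -eE.
have [uQ uR] := mulmx1_unit QR.
have RE : invmx Q = R by rewrite -[RHS](mulKmx uQ) QR mulmx1.
have act s M : galact_mx e s M <-> galact_mx e' s (R *m M *m Q).
  rewrite !galact_mxP -!lincomb_mul -eE.
  have -> : (fun i => galact s (e' i)) = lincomb (fun i => galact s (e i)) Q.
    by apply/funext => j; rewrite [in LHS]e'E galact_lincomb.
  split=> [-> //|/(congr1 (fun f => lincomb f R))].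
  by rewrite lincomb_mul (lincomb_mul (lincomb e M)) QR !lincomb1.
exists Q => //; rewrite RE; apply/seteqP; split=> [M [s /act sM]|_ [M [s sM] <-]].
  exists (R *m M *m Q); first by exists s.
  by rewrite !mulmxA QR mul1mx -mulmxA QR mulmx1.
exists s; apply/act; rewrite !mulmxA.
have [_ RQ] : Q *m R = 1%:M /\ R *m Q = 1%:M by split=> //; exact: mulmx1C.
by rewrite RQ mul1mx -mulmxA RQ mulmx1.
Qed.

End CharacterLattice.

(** * Tori over Q *)

Lemma regfun_sub (k k' : {pred algC}) N (f : 'M[algC]_N -> algC) :
  {subset k <= k'} -> regfun k f -> regfun k' f.
Proof.
move=> kk'; elim=> [c /kk' ck'|i j||f1 f2 _ r1 _ r2|f1 f2 _ r1 _ r2].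
- exact: regfun_cst.
- exact: regfun_entry.
- exact: regfun_invdet.
- exact: regfun_add.
- exact: regfun_mul.
Qed.

Lemma CratN1 : (-1 : algC) \in Crat. Proof. by rewrite rpredN rpred1. Qed.

Section Tori.
Implicit Types (T : Qgroup) (s : GQ).

Lemma char_intro T (f : 'M[algC]_(deg T) -> algC) : regfun predT f ->
  (forall x, pts T x -> f x != 0) ->
  (forall x y, pts T x -> pts T y -> f (x *m y) = f x * f y) ->
  exists c : char T, forall x, pts T x -> c x = f x.
Proof.
move=> rf f0 fM.
suff fP : is_char (fun x => (`[< pts T x >])%:R * f x).
  by exists (MkChar fP) => x Tx /=; rewrite asboolT // mul1r.
split=> [x /asboolPn/negbTE ->|x Tx|x y Tx Ty|]; first by rewrite mul0r.
- by rewrite asboolT // mul1r f0.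
- by rewrite !asboolT ?mul1r ?fM //; exact: pts_mul.
- by exists f => // x Tx; rewrite asboolT // mul1r.
Qed.

Lemma char_pullback U U' (phi : 'M[algC]_(deg U) -> 'M[algC]_(deg U')) :
  (forall i j, regfun Crat (fun x => phi x i j)) ->
  (forall x, pts U x -> pts U' (phi x)) ->
  (forall x y, pts U x -> pts U y -> phi (x *m y) = phi x *m phi y) ->
  forall c' : char U', exists c : char U, forall x, pts U x -> c x = c' (phi x).
Proof.
move=> rphi UU' phiM c'; have [_ c0 cM [f rf cf]] := cfunP c'.
have rphi' i j : regfun predT (fun x => phi x i j) by exact: regfun_sub (rphi i j).
have [g rg gE] := regfun_comp (pts_matrix_group U) (pts_matrix_group U') UU' phiM
  isT isT isT rphi' rf.
have gc x : pts U x -> g x = c' (phi x) by move=> Ux; rewrite -gE // -cf //; exact: UU'.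
have [x Ux|x y Ux Uy|c cE] := char_intro rg.
- by rewrite gc // c0 //; exact: UU'.
- by rewrite !gc ?phiM ?cM //; try exact: UU'; exact: pts_mul.
- by exists c => x Ux; rewrite cE // gc.
Qed.

(** Characters pull back along the isomorphism, and the pullback commutes with
    Galois because the isomorphism is defined over Q. *)
Lemma isom_gal_image n T T' (e' : 'I_n -> char T') :
  isom_over Crat (pts T) (pts T') -> char_basis e' ->
  exists2 e : 'I_n -> char T, char_basis e & gal_image e = gal_image e'.
Proof.
move=> TT' eB'; move: TT' => [phi [psi [rphi rpsi TT' T'T' phiM]]].
have psiM y y' : pts T' y -> pts T' y' -> psi (y *m y') = psi y *m psi y'.
  move=> Ty Ty'; have [Gy yE] := T'T' _ Ty; have [Gy' yE'] := T'T' _ Ty'.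
  by rewrite -[in LHS]yE -[in LHS]yE' -phiM //; have [] := TT' _ (pts_mul Gy Gy').
have phiT x : pts T x -> pts T' (phi x) by move=> /TT'[].
have psiT y : pts T' y -> pts T (psi y) by move=> /T'T'[].
have /fin_all_exists[e eE] i := char_pullback rphi phiT phiM (e' i).
have esum m x : pts T x -> (\sum_i e i *~ m i) x = (\sum_i e' i *~ m i) (phi x).
  move=> Tx; rewrite !char_sumE //; last exact: phiT.
  by apply: eq_bigr => i _; rewrite !char_mulrzE ?eE //; exact: phiT.
exists e.
  move=> c; have [c' cE] := char_pullback rpsi psiT psiM c.
  have [m [mE m_uniq]] := eB' c'; exists m; split=> [|m' m'E].
    apply: char_ext => x Tx; have [T'x xE] := TT' _ Tx.
    by rewrite esum // -mE cE // xE.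
  apply: m_uniq; apply: char_ext => y Ty; have [Tpy yE] := T'T' _ Ty.
  by rewrite cE // m'E esum // yE.
have act s j x : pts T x -> galact s (e j) x = galact s (e' j) (phi x).
  move=> Tx; rewrite !galactE eE -?pts_gal //; congr (s (e' j _)).
  by apply/matrixP => a b; rewrite mxE (regfun_Crat _ (rphi a b)).
apply/seteqP; split=> M [s sM]; exists s => j.
  apply: char_ext => y Ty; have [Tpy yE] := T'T' _ Ty.
  by rewrite -yE -act // sM esum.
by apply: char_ext => x Tx; rewrite act // sM esum.
Qed.

(** Composed with psi, a character of T becomes a multiplicative Laurent
    polynomial on G_m^n, hence a monomial in the coordinates. *)
Lemma torus_char_basis n T (phi : 'M[algC]_(deg T) -> 'M[algC]_n)
    (psi : 'M[algC]_n -> 'M[algC]_(deg T)) :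
  (forall i j, regfun predT (fun x => phi x i j)) ->
  (forall i j, regfun predT (fun x => psi x i j)) ->
  (forall x, pts T x -> @Gm_pow n (phi x) /\ psi (phi x) = x) ->
  (forall y, @Gm_pow n y -> pts T (psi y) /\ phi (psi y) = y) ->
  (forall x x', pts T x -> pts T x' -> phi (x *m x') = phi x *m phi x') ->
  exists2 d : 'I_n -> char T, char_basis d & forall i x, pts T x -> d i x = phi x i i.
Proof.
move=> rphi rpsi TG GT phiM.
have psiM y y' : Gm_pow y -> Gm_pow y' -> psi (y *m y') = psi y *m psi y'.
  move=> Gy Gy'; have [Ty yE] := GT _ Gy; have [Ty' yE'] := GT _ Gy'.
  by rewrite -[in LHS]yE -[in LHS]yE' -phiM //; have [] := TG _ (pts_mul Ty Ty').
have /fin_all_exists[d dE] (i : 'I_n) : exists c : char T, forall x, pts T x -> c x = phi x i i.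
  apply: char_intro => // [x /TG[/Gm_pow_diag_neq0]//|x y Tx Ty].
  by rewrite phiM // Gm_pow_mul_diag //; have [] := TG _ Tx.
have dsum m x : pts T x -> (\sum_i d i *~ m i) x = monomial m (phi x).
  by move=> Tx; rewrite char_sumE //; apply: eq_bigr => i _; rewrite char_mulrzE // dE.
exists d => // c.
have [_ c1 cM [f rf cf]] := cfunP c.
have GT1 y : Gm_pow y -> pts T (psi y) by move=> /GT[].
have [g rg gE] := regfun_comp (Gm_pow_matrix_group n) (pts_matrix_group T) GT1 psiM isT isT isT rpsi rf.
have gc y : Gm_pow y -> g y = c (psi y) by move=> Gy; rewrite -gE // -cf //; exact: GT1.
have G1 := mxgrp1 (Gm_pow_matrix_group n).
have [||m mE] := multiplicative_laurent (regfun_laurent rg).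
- by rewrite gc // c1 //; exact: GT1.
- move=> x y Gx Gy; rewrite !gc ?psiM ?cM //; try exact: GT1.
  exact: (mxgrpM (Gm_pow_matrix_group n)).
exists m; split=> [|m' cE].
  apply: char_ext => x Tx; have [Gx xE] := TG _ Tx.
  by rewrite dsum // -mE // gc // xE.
apply: monomial_inj => y Gy; have [Ty yE] := GT _ Gy.
by rewrite -mE // gc // cE dsum // yE.
Qed.

Lemma torus_gal_image n T : is_torus n T ->
  exists2 e : 'I_n -> char T, char_basis e &
    exists2 H : {fset 'M[int]_n}, finite_subgroup H & gal_image e = [set` H].
Proof.
move=> [phi [psi [rphi rpsi TG GT phiM]]].
have [e eB _] := torus_char_basis rphi rpsi TG GT phiM.
by exists e => //; exact: gal_image_finite_subgroup.
Qed.

Lemma Gm_pow_gal n s (x : 'M[algC]_n) : Gm_pow x -> Gm_pow (map_mx s x).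
Proof.
move=> /Gm_powP[d -> d0]; apply/Gm_powP; exists (map_mx s d).
  by rewrite map_diag_mx.
by move=> i; rewrite mxE fmorph_eq0.
Qed.

(** Galois fixes all the characters, hence commutes with the isomorphism onto
    G_m^n and with its inverse, and both descend to the rational field. *)
Lemma trivial_gal_image_split n T (e : 'I_n -> char T) : is_torus n T ->
  char_basis e -> gal_image e `<=` [set 1%:M] -> isom_over Crat (pts T) (@Gm_pow n).
Proof.
move=> [phi [psi [rphi rpsi TG GT phiM]]] eB e1.
have [d _ dE] := torus_char_basis rphi rpsi TG GT phiM.
have fix_char s (c : char T) : galact s c = c.
  have [M sM] := galact_mx_exists eB s.
  have M1 : M = 1%:M by apply: e1; exists s.
  have [A cA] := lincomb_surj eB (fun _ : 'I_1 => c).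
  have cE : c = lincomb e A ord0 by exact: (congr1 (fun f => f ord0) cA).
  rewrite cE galact_lincomb; congr (lincomb _ A ord0); move/galact_mxP: sM => ->.
  by rewrite M1 lincomb1.
have phi_gal s x : pts T x -> phi (map_mx s x) = map_mx s (phi x).
  move=> Tx; have Tsx : pts T (map_mx s x) by rewrite -pts_gal.
  have diag y : pts T y -> phi y = diag_mx (\row_i d i y).
    move=> Ty; have [/Gm_powP[u uE _] _] := TG _ Ty; rewrite uE; congr diag_mx.
    by apply/rowP => i; rewrite !mxE dE // uE mxE eqxx mulr1n.
  rewrite !diag // map_diag_mx; congr diag_mx; apply/rowP => i; rewrite !mxE.
  by rewrite -[in LHS](fix_char s (d i)) galactE map_mx_autVK.
have psi_gal s y : Gm_pow y -> psi (map_mx s y) = map_mx s (psi y).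
  move=> Gy; have [Ty yE] := GT _ Gy.
  have Tsy : pts T (map_mx s (psi y)) by rewrite -pts_gal.
  by have [_ <-] := TG _ Tsy; rewrite phi_gal // yE.
have descent N M (D : set 'M[algC]_N) (f : 'M[algC]_N -> 'M[algC]_M) :
    (forall i j, regfun predT (fun x => f x i j)) ->
    (forall s x, D x -> D (map_mx s x)) ->
    (forall s x, D x -> f (map_mx s x) = map_mx s (f x)) ->
    exists2 g : 'M[algC]_N -> 'M[algC]_M, forall i j, regfun Crat (fun x => g x i j)
      & forall x, D x -> f x = g x.
  move=> rf Dgal fgal.
  have /fin_all_exists2[g rg gE] (ij : 'I_M * 'I_M) : exists2 g, regfun Crat g &
      forall x, D x -> f x ij.1 ij.2 = g x.
    by apply: regfun_galois_descent => // s x Dx; rewrite fgal // mxE.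
  exists (fun x => \matrix_(i, j) g (i, j) x) => [i j|x Dx].
    by under eq_fun do rewrite mxE; exact: rg.
  by apply/matrixP => i j; rewrite mxE -gE.
have [|phi' rphi' phiE] := descent _ _ (pts T) phi rphi _ phi_gal.
  by move=> s x; rewrite -pts_gal.
have [|psi' rpsi' psiE] := descent _ _ (@Gm_pow n) psi rpsi _ psi_gal.
  by move=> s x; exact: Gm_pow_gal.
exists phi', psi'; split=> // [x Tx|y Gy|x x' Tx Tx'].
- by have [Gx xE] := TG _ Tx; rewrite -phiE // -psiE.
- by have [Ty yE] := GT _ Gy; rewrite -psiE // -phiE.
- by rewrite -!phiE ?phiM //; exact: pts_mul.
Qed.

Lemma iso_class_eqP T T' : iso_class T = iso_class T' <-> isom_over Crat (pts T) (pts T').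
Proof.
have grp := pts_matrix_group; have Q0 := rpred0 Crat; have Q1 := rpred1 Crat.
split=> [TT'|TT'].
  have : iso_class T' T' by exact: isom_over_refl.
  by rewrite -TT'.
apply/seteqP; split=> U.
  apply: (isom_over_trans Q0 Q1 CratN1) => //; exact: isom_over_sym.
exact: (isom_over_trans Q0 Q1 CratN1).
Qed.

Lemma trivial_gal_image_iso_class n T T' (e : 'I_n -> char T) (e' : 'I_n -> char T') :
  is_torus n T -> is_torus n T' -> char_basis e -> char_basis e' ->
  gal_image e `<=` [set 1%:M] -> gal_image e' `<=` [set 1%:M] -> iso_class T = iso_class T'.
Proof.
move=> Tt Tt' eB eB' e1 e1'; apply/iso_class_eqP.
have grp := pts_matrix_group; have gG := Gm_pow_matrix_group n.
apply: (isom_over_trans (rpred0 Crat) (rpred1 Crat) CratN1 _ gG) => //.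
  exact: trivial_gal_image_split e1.
by apply: isom_over_sym => //; exact: trivial_gal_image_split e1'.
Qed.

End Tori.

(** * Comparison of growth rates *)

Section Asymptotics.
Variable R : realType.

Lemma near_ln_ge (A : R) : \forall X \near +oo, A <= ln X.
Proof.
near=> X.
have eX : expR A <= X by near: X; apply: nbhs_pinfty_ge; rewrite num_real.
by rewrite -[A]expRK ler_ln // posrE ?expR_gt0 // (lt_le_trans (expR_gt0 A) eX).
Unshelve. all: by end_near. Qed.

Lemma cvg_ln_pinfty : (ln X : R) @[X --> +oo] --> +oo.
Proof. by apply/cvgryPge => A; exact: near_ln_ge. Qed.

Lemma cvg_inv_ln : (ln X : R)^-1 @[X --> +oo] --> 0.
Proof.
apply/gtr0_cvgV0; last exact: cvg_ln_pinfty.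
near=> X; apply: (lt_le_trans (ltr01)); near: X; exact: near_ln_ge.
Unshelve. all: by end_near. Qed.

Lemma expR_half_dominates (y : R) (p : nat) : 1 <= y ->
  expR (- (y / 2)) * y ^+ p <= (p.+1)`!%:R * 2 ^+ p.+1 / y.
Proof.
move=> y1; have y0 : 0 < y by exact: lt_le_trans y1.
have f0 : 0 < (p.+1)`!%:R :> R by rewrite ltr0n fact_gt0.
have := expR_ge1Dxn p (ltW (divr_gt0 y0 (ltr0n _ 2))).
set E := expR _ => Ele.
have : (y / 2) ^+ p.+1 / (p.+1)`!%:R <= E by apply: le_trans Ele; rewrite lerDr.
rewrite ler_pdivrMr // expr_div_n ler_pdivrMr ?exprn_gt0 // => yE.
rewrite expRN -/E ler_pdivlMr // mulrAC -mulrA -exprS mulrC ler_pdivrMr ?expR_gt0 //.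
by rewrite (le_trans yE) // -mulrA mulrC.
Qed.

(** Outside the case of equality the quotient is at most a constant over ln X:
    if a = 1 a factor ln X is missing, and if a >= 2 then X^(1/a - 1) is at most
    X^(-1/2), which beats every power of ln X. *)
Lemma comparison_cvg (a p q : nat) : (0 < a)%N -> (a = 1 -> p <= q)%N ->
  X `^ a%:R^-1 * ln X ^+ p / (X * ln X ^+ q) @[X --> +oo] -->
    (if (a == 1)%N && (p == q) then 1 else 0 : R).
Proof.
move=> a0 apq; case: ifP => [/andP[/eqP -> /eqP ->]|main].
  apply: cvg_near_cst; near=> X.
  have X0 : 0 < X by near: X; apply: nbhs_pinfty_gt; rewrite num_real.
  have lX : 1 <= ln X by near: X; exact: near_ln_ge.
  rewrite invr1 powRr1 ?(ltW X0) // divff // mulf_neq0 ?gt_eqF // exprn_gt0 //.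
  exact: lt_le_trans lX.
pose K : R := Num.max 1 ((p.+1)`!%:R * 2 ^+ p.+1).
apply: (@squeeze_cvgr _ _ _ _ (fun=> 0) (fun X => K * (ln X)^-1)); last 2 first.
- exact: cvg_cst.
- by rewrite -[X in _ --> X](mulr0 K); apply: cvgM; [exact: cvg_cst|exact: cvg_inv_ln].
near=> X.
have X0 : 0 < X by near: X; apply: nbhs_pinfty_gt; rewrite num_real.
have l1 : 1 <= ln X by near: X; exact: near_ln_ge.
have l0 : 0 < ln X by exact: lt_le_trans l1.
apply/andP; split.
  by rewrite divr_ge0 ?mulr_ge0 ?powR_ge0 ?exprn_ge0 // ltW.
have XE : X = expR (ln X) by rewrite lnK.
have [a1|a1] := eqVneq a 1%N.
  have pq : (p < q)%N by rewrite ltn_neqAle apq // andbT; move: main; rewrite a1 eqxx /= => ->.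
  rewrite a1 invr1 powRr1 ?(ltW X0) // -mulf_div divff ?gt_eqF // mul1r.
  have qE : ln X ^+ q = ln X ^+ (q - p).-1 * ln X * ln X ^+ p.
    by rewrite -exprSr -exprD; congr (_ ^+ _); lia.
  have u1 : 1 <= ln X ^+ (q - p).-1 by exact: exprn_ege1.
  have u0 := lt_le_trans ltr01 u1; have v0 : 0 < ln X ^+ p by exact: exprn_gt0.
  have -> : ln X ^+ p / ln X ^+ q = (ln X ^+ (q - p).-1)^-1 * (ln X)^-1.
    by rewrite qE; field; rewrite !gt_eqF.
  by rewrite /= ler_pM2r ?invr_gt0 // /K le_max invf_le1 ?u1.
have a2 : (2 <= a)%N by lia.
have Xa : X `^ a%:R^-1 / X <= expR (- (ln X / 2)).
  rewrite /powR gt_eqF // {2}XE -expRN -expRD ler_expR.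
  have : a%:R^-1 <= 2^-1 :> R by rewrite lef_pV2 ?posrE ?ltr0n // ler_nat.
  by nra.
rewrite -mulf_div; apply: (@le_trans _ _ (expR (- (ln X / 2)) * ln X ^+ p)).
  apply: ler_pM => //.
  - by rewrite divr_ge0 ?powR_ge0 // ltW.
  - by rewrite divr_ge0 // exprn_ge0 // ltW.
  - by rewrite ler_pdivrMr ?exprn_gt0 // ler_peMr ?exprn_ge0 ?(ltW l0) // exprn_ege1.
apply: le_trans (expR_half_dominates p l1) _.
by rewrite /= ler_pM2r ?invr_gt0 // /K le_max lexx orbT.
Unshelve. all: by end_near. Qed.

Lemma asymp_equiv_cvg (f : R -> R) (c : R) (a p q : nat) : 0 < c ->
  (0 < a)%N -> (a = 1 -> p <= q)%N ->
  asymp_equiv f (fun X => c * X `^ a%:R^-1 * ln X ^+ p) ->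
  f X / (X * ln X ^+ q) @[X --> +oo] --> (if (a == 1)%N && (p == q) then c else 0).
Proof.
move=> c0 a0 apq fh.
set l := (if _ then c else 0).
have lE : l = 1 * (c * (if (a == 1)%N && (p == q) then 1 else 0)).
  by rewrite /l mul1r; case: ifP; rewrite ?mulr1 ?mulr0.
have prod_cvg : (f X / (c * X `^ a%:R^-1 * ln X ^+ p)) *
    (c * (X `^ a%:R^-1 * ln X ^+ p / (X * ln X ^+ q))) @[X --> +oo] --> l.
  rewrite lE; apply: cvgM; first exact: fh.
  by apply: cvgM; [exact: cvg_cst|exact: comparison_cvg].
refine (cvg_trans (near_eq_cvg _) prod_cvg); near=> X.
have X0 : 0 < X by near: X; apply: nbhs_pinfty_gt; rewrite num_real.
have l1 : 1 <= ln X by near: X; exact: near_ln_ge.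
have l0 : 0 < ln X by exact: lt_le_trans l1.
rewrite /=; set P := X `^ _; have P0 : 0 < P by exact: powR_gt0.
have lp : 0 < ln X ^+ p by exact: exprn_gt0.
have lq : 0 < ln X ^+ q by exact: exprn_gt0.
move: (ln X ^+ p) (ln X ^+ q) lp lq => u v u0 v0.
by field; rewrite !gt_eqF.
Unshelve. all: by end_near. Qed.

(** The quotient of 0 by anything tends to 0, not to 1. *)
Lemma asymp_equiv_not_eventually_zero (f g : R -> R) (X0 : R) : asymp_equiv f g ->
  ~ (forall X, X0 <= X -> f X = 0).
Proof.
move=> fg f0.
have fg0 : f X / g X @[X --> +oo] --> (0 : R).
  apply: cvg_near_cst; near=> X.
  have X0X : X0 <= X by near: X; apply: nbhs_pinfty_ge; rewrite num_real.
  by rewrite f0 // mul0r.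
have /eqP : (1 : R) = 0 by exact: (cvg_unique (@Rhausdorff R) fg fg0).
by rewrite oner_eq0.
Unshelve. all: by end_near. Qed.

End Asymptotics.

(** * Counting tori class by class *)

Lemma conj_GLnZ_refl n (A : set 'M[int]_n) : conj_GLnZ A A.
Proof.
exists 1%:M; first exact: unitmx1.
have fixed h : 1%:M *m h *m invmx 1%:M = h by rewrite mul1mx invmx1 mulmx1.
apply/seteqP; split=> [h hA|_ [h hA <-]]; last by rewrite fixed.
by exists h; [|exact: fixed].
Qed.

Lemma conj_GLnZ_trans n (A B C : set 'M[int]_n) : conj_GLnZ A B -> conj_GLnZ B C -> conj_GLnZ A C.
Proof.
move=> [g ug ->] [h uh ->]; exists (g *m h); first by rewrite unitmx_mul ug.
have E x : g *m (h *m x *m invmx h) *m invmx g = g *m h *m x *m invmx (g *m h).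
  by rewrite invmx_mul // !mulmxA.
apply/seteqP; split=> [_ [_ [x xC <-] <-]|_ [x xC <-]]; first by exists x.
by rewrite -E; exists (h *m x *m invmx h) => //; exists x.
Qed.

Lemma conj_GLnZ_sym n (A B : set 'M[int]_n) : conj_GLnZ A B -> conj_GLnZ B A.
Proof.
move=> [g ug ->]; exists (invmx g); first by rewrite unitmx_inv.
have E x : invmx g *m (g *m x *m invmx g) *m invmx (invmx g) = x.
  by rewrite invmxK -!mulmxA mulVmx // mulmx1 mulKmx.
apply/seteqP; split=> [x xB|_ [_ [x xB <-] <-]]; last by rewrite E.
by exists (g *m x *m invmx g); [exists x|exact: E].
Qed.

(** A prescribed x0 is kept among the representatives: later the values of a and b
    are known for the sign group itself, not for its conjugates. *)
Lemma exists_representatives (T : eqType) (R : T -> T -> Prop) (x0 : T) (s : seq T) :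
  (forall x, R x x) -> (forall x y, R x y -> R y x) ->
  exists l : seq T, [/\ uniq l, x0 \in l, {subset l <= x0 :: s},
    forall x, x \in s -> exists2 y, y \in l & R x y
    & forall x y, x \in l -> y \in l -> R x y -> x = y].
Proof.
move=> Rxx Rsym; elim: s => [|x s [l [l_uniq lx0 ls cover sep]]].
  by exists [:: x0]; split=> // [|x y]; rewrite !inE // => /eqP -> /eqP ->.
have ls' : {subset l <= x0 :: x :: s}.
  by move=> y /ls; rewrite !inE => /orP[->//|->]; rewrite !orbT.
have [[y yl xy]|far] := pselect (exists2 y, y \in l & R x y).
  exists l; split=> // z; rewrite inE => /predU1P[->|]; last exact: cover.
  by exists y.
have xl : x \notin l by apply/negP => xl; apply: far; exists x.
exists (x :: l); split=> [|||z|y z].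
- by rewrite /= xl.
- by rewrite inE lx0 orbT.
- by move=> y; rewrite inE => /predU1P[->|/ls']; rewrite // !inE eqxx orbT.
- rewrite inE => /predU1P[->|/cover[y yl zy]]; first by exists x; rewrite ?mem_head.
  by exists y; rewrite // inE yl orbT.
- rewrite !inE => /predU1P[->|yl] /predU1P[->|zl] // yz; last exact: sep.
    by exfalso; apply: far; exists z.
  by exfalso; apply: far; exists y => //; exact: Rsym.
Qed.

Lemma finite_subgroup_representatives n : exists l : seq {fset 'M[int]_n},
  [/\ uniq l, sign_group n \in l, forall H, H \in l -> finite_subgroup H,
      forall H, finite_subgroup H -> exists2 H', H' \in l & conj_GLnZ [set` H] [set` H']
    & forall H H', H \in l -> H' \in l -> conj_GLnZ [set` H] [set` H'] -> H = H'].
Proof.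
have [s [sG cover]] := finite_subgroup_classes n.
have [|H H'|l [l_uniq l0 ls lcover sep]] := @exists_representatives _
    (fun H H' : {fset 'M[int]_n} => conj_GLnZ [set` H] [set` H']) (sign_group n) s.
- by move=> H; exact: conj_GLnZ_refl.
- exact: conj_GLnZ_sym.
exists l; split=> // [H /ls|H /cover[H1 /lcover[H2 H2l H12] HH1]].
  by rewrite inE => /predU1P[->|/sG//]; exact: sign_group_finite_subgroup.
by exists H2 => //; exact: conj_GLnZ_trans HH1 H12.
Qed.

Lemma ncard_bigcup (T I : choiceType) (l : seq I) (F : I -> set T) : uniq l ->
  (forall i, i \in l -> finite_set (F i)) ->
  (forall i j x, i \in l -> j \in l -> F i x -> F j x -> i = j) ->
  finite_set [set x | exists2 i, i \in l & F i x] /\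
  ncard [set x | exists2 i, i \in l & F i x] = (\sum_(i <- l) ncard (F i))%N.
Proof.
elim: l => [_ _ _|i l IHl /andP[il l_uniq] Ffin Fdisj].
  have -> : [set x | exists2 i, i \in [::] & F i x] = set0 by apply/seteqP; split=> x // [].
  split; first exact: finite_set0.
  by rewrite ncard_fset // fset_set0 big_nil.
have [|j k x jl kl|Ufin Ucard] := IHl l_uniq.
- by move=> j jl; apply: Ffin; rewrite inE jl orbT.
- by apply: Fdisj; rewrite inE ?jl ?kl orbT.
set U := [set x | exists2 j, j \in l & F j x] in Ufin Ucard.
have Fi : finite_set (F i) by apply: Ffin; exact: mem_head.
have -> : [set x | exists2 j, j \in i :: l & F j x] = F i `|` U.
  apply/seteqP; split=> [x [j]|x [Fx|[j jl Fx]]].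
  - by rewrite inE => /predU1P[->|jl] Fx; [left|right; exists j].
  - by exists i; rewrite ?mem_head.
  - by exists j; rewrite // inE jl orbT.
have disj : F i `&` U = set0.
  apply/seteqP; split=> // x [Fx [j jl Fjx]].
  have ij : i = j by apply: (Fdisj _ _ x) => //; rewrite inE ?eqxx ?jl ?orbT.
  by move: il; rewrite ij jl.
split; first by rewrite finite_setU.
rewrite big_cons -Ucard !ncard_fset ?finite_setU // fset_setU // cardfsU -fset_setI // disj.
by rewrite fset_set0 cardfs0 subn0.
Qed.

Section Counting.
Variables (R : realType) (n : nat).
Implicit Types (H : {fset 'M[int]_n}) (X : R).

Definition tori_with_image H X : set (set Qgroup) :=
  [set iso_class T | T in
    [set T | [/\ is_torus n T, conductor R n T <= X &
       exists2 e : 'I_n -> char T, char_basis e &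
         conj_GLnZ (gal_image e) [set` H]]]].

Lemma NtorHE H X : NtorH H X = ncard (tori_with_image H X).
Proof. by []. Qed.

Lemma tori_with_image_disjoint H H' X c : tori_with_image H X c ->
  tori_with_image H' X c -> conj_GLnZ [set` H] [set` H'].
Proof.
move=> [T [Tt _ [e eB eH]] <-] [T' [Tt' _ [e' eB' eH']] TT'].
have [e2 eB2 e2E] := isom_gal_image ((iso_class_eqP T T').1 (esym TT')) eB'.
apply: conj_GLnZ_trans (conj_GLnZ_sym eH) _.
apply: conj_GLnZ_trans (gal_image_basis_change eB eB2) _.
by rewrite e2E.
Qed.

Lemma tori_with_image_cover (l : seq {fset 'M[int]_n}) X :
  (forall H, finite_subgroup H -> exists2 H', H' \in l & conj_GLnZ [set` H] [set` H']) ->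
  [set iso_class T | T in [set T | is_torus n T /\ conductor R n T <= X]] =
  [set c | exists2 H, H \in l & tori_with_image H X c].
Proof.
move=> cover; apply/seteqP; split=> [_ [T [Tt TX] <-]|_ [H _ [T [Tt TX _] <-]]]; last by exists T.
have [e eB [H HG eH]] := torus_gal_image Tt.
have [H' H'l HH'] := cover H HG; exists H' => //.
by exists T => //; split=> //; exists e; rewrite ?eH.
Qed.

Lemma tori_with_trivial_image X :
  exists c, tori_with_image [fset 1%:M]%fset X `<=` [set c].
Proof.
have [[T [Tt TX [e eB e1]]]|none] := pselect (exists T, [/\ is_torus n T, conductor R n T <= X &
    exists2 e : 'I_n -> char T, char_basis e & conj_GLnZ (gal_image e) [set` [fset 1%:M]%fset]]);
  last by exists set0 => _ [T TP <-]; exfalso; apply: none; exists T.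
have triv U (u : 'I_n -> char U) : conj_GLnZ (gal_image u) [set` [fset 1%:M]%fset] ->
    gal_image u `<=` [set 1%:M].
  move=> [g ug ->] _ [h /= h1 <-]; move: h1; rewrite inE => /eqP ->.
  by rewrite /= mulmx1 mulmxV.
exists (iso_class T) => _ [T' [Tt' _ [e' eB' e1']] <-] /=.
by apply: (trivial_gal_image_iso_class Tt' Tt eB' eB); exact: triv.
Qed.

(** The number ncard of an infinite set is 0, and these sets grow with X: if one
    of them were infinite, the counting function would vanish from there on. *)
Lemma tori_with_image_finite H (g : R -> R) X :
  asymp_equiv (fun X => (NtorH H X)%:R) g -> finite_set (tori_with_image H X).
Proof.
move=> Hg; apply: contrapT => inf; apply: (asymp_equiv_not_eventually_zero (X0 := X) Hg) => Y XY.
rewrite /NtorH (_ : ncard _ = 0%N) //; apply: ncard_infinite.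
apply: contra_not inf; apply: sub_finite_set => _ [T [Tt TX Te] <-].
by exists T => //; split=> //; exact: le_trans XY.
Qed.

End Counting.

Lemma cvg_sum_seq (R : realType) (I : Type) (l : seq I) (f : I -> R -> R) (c : I -> R) :
  (forall i, f i X @[X --> +oo] --> c i) ->
  \sum_(i <- l) f i X @[X --> +oo] --> \sum_(i <- l) c i.
Proof.
move=> fc; elim: l => [|i l IHl].
  by rewrite big_nil; under eq_fun do rewrite big_nil; exact: cvg_cst.
by rewrite big_cons; under eq_fun do rewrite big_cons; apply: cvgD.
Qed.

Theorem corollary3p7 (R : realType) :
  (forall (n : nat) (H : {fset 'M[int]_n}),
     (1 <= n)%N -> finite_subgroup H -> H != [fset 1%:M]%fset ->
     exists2 c : R, 0 < c &
       asymp_equiv (fun X : R => (NtorH H X)%:R)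
         (fun X : R => c * X `^ (a_inv H)%:R^-1 * ln X ^+ (b_inv H - 1))) ->
  forall n : nat, (1 <= n)%N ->
    exists2 c : R, 0 < c &
      asymp_equiv (fun X : R => (Ntor n X)%:R)
        (fun X : R => c * X * ln X ^+ (n - 1)).
Proof.
move=> NH n n1; have [l [l_uniq l0 lG cover sep]] := finite_subgroup_representatives n.
pose g (X : R) := X * ln X ^+ (n - 1).
have sign1 := sign_group_neq1 n1.
have Hfin H X : H \in l -> finite_set (@tori_with_image R n H X).
  move=> Hl; have [->|H1] := eqVneq H [fset 1%:M]%fset.
    have [c sub] := @tori_with_trivial_image R n X.
    by apply: sub_finite_set sub _; exact: finite_set1.
  by have [c _ Hc] := NH n H n1 (lG H Hl) H1; exact: tori_with_image_finite Hc.
(* The contribution of each class, which is 0 for the trivial class. *)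
have /choice[c cP] H : exists c : R, H \in l ->
    [/\ (NtorH H X)%:R / g X @[X --> +oo] --> c, 0 <= c & H = sign_group n -> 0 < c].
  have [Hl|_] := boolP (H \in l); last by exists 0.
  have [->|H1] := eqVneq H [fset 1%:M]%fset.
    exists 0 => _; split=> // [|e1]; last by rewrite -e1 eqxx in sign1.
    apply: (@squeeze_cvgr _ _ _ _ (fun=> 0) (fun X => (ln X)^-1)); last 2 first.
    - exact: cvg_cst.
    - exact: cvg_inv_ln.
    near=> X.
    have X0 : 0 < X by near: X; apply: nbhs_pinfty_gt; rewrite num_real.
    have l1 : 1 <= ln X by near: X; exact: near_ln_ge.
    have lX : ln X <= X by rewrite -[leRHS]lnK // (le_trans _ (expR_ge1Dx _)) // lerDr.
    have gX : ln X <= g X.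
      by rewrite (le_trans lX) // /g ler_peMr ?(ltW X0) // exprn_ege1.
    have l_gt0 := lt_le_trans ltr01 l1; have g0 := lt_le_trans l_gt0 gX.
    rewrite divr_ge0 ?(ltW g0) //= ler_pdivrMr //.
    apply: (@le_trans _ _ 1%:R); last by rewrite mulrC ler_pdivlMr // mul1r.
    rewrite ler_nat; have [d sub] := @tori_with_trivial_image R n X.
    rewrite NtorHE ncard_fset; last by apply: sub_finite_set sub _; exact: finite_set1.
    apply: leq_trans (_ : #|` fset_set [set d]| <= 1)%N; last by rewrite fset_set1 cardfs1.
    apply: fsubset_leq_card; rewrite -fset_set_sub //.
    by apply: sub_finite_set sub _; exact: finite_set1.
  have [c0 c0_gt0 Hc] := NH n H n1 (lG H Hl) H1.
  have ab : (a_inv H = 1 -> b_inv H - 1 <= n - 1)%N.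
    by move=> a1; rewrite leq_sub2r // b_inv_le //; exact: lG.
  exists (if (a_inv H == 1)%N && (b_inv H - 1 == n - 1)%N then c0 else 0) => _; split.
  - exact: (asymp_equiv_cvg c0_gt0 (a_inv_gt0 H n1) ab Hc).
  - by case: ifP => // _; exact: ltW.
  - by move=> ->; rewrite sign_group_a_inv // sign_group_b_inv // !eqxx.
(* The test H \in l allows a limit to be taken for every index H. *)
pose C := \sum_(H <- l) (if H \in l then c H else 0).
have C_gt0 : 0 < C.
  have [_ _ /(_ erefl) c0] := cP _ l0.
  rewrite /C (bigD1_seq (sign_group n)) //= l0 ltr_wpDr //.
  apply: sumr_ge0 => H _; case: ifP => // Hl.
  by have [_ ge0 _] := cP H Hl.
have NE (X : R) : (Ntor n X)%:R = \sum_(H <- l) (NtorH H X)%:R :> R.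
  rewrite /Ntor (tori_with_image_cover X cover).
  have [|H H' x Hl H'l Hx H'x|_ ->] := @ncard_bigcup _ _ l (fun H => @tori_with_image R n H X) l_uniq.
  - by move=> H; exact: Hfin.
  - by apply: sep => //; exact: tori_with_image_disjoint Hx H'x.
  - by rewrite natr_sum.
have limC : (Ntor n X)%:R / g X @[X --> +oo] --> C.
  under eq_fun do rewrite NE mulr_suml big_seq.
  under eq_fun do rewrite big_mkcond /=.
  apply: cvg_sum_seq => H; case: ifP => [/cP[]//|_]; exact: cvg_cst.
exists C => //.
rewrite /asymp_equiv.
have -> : (fun X => (Ntor n X)%:R / (C * X * ln X ^+ (n - 1))) =
    (fun X => C^-1 * ((Ntor n X)%:R / g X)).
  by apply/funext => X; rewrite /g -mulrA invfM mulrCA.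
rewrite -[X in _ --> X](mulVf (lt0r_neq0 C_gt0)).
by apply: cvgM limC; exact: cvg_cst.
Unshelve. all: by end_near. Qed.
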